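(* Let $X$ be a proper CAT(0) space. Then the contracting boundary $\partial_c X$, equipped with the direct limit topology, is: (1) $\sigma$-compact; (2) a visibility space, i.e. for any two distinct points $\xi,\eta\in\partial_cX$ there is a bi-infinite geodesic $\gamma:\mathbb{R}\to X$ with $\gamma(\infty)=\xi$ and $\gamma(-\infty)=\eta$; (3) a quasi-isometry invariant, i.e. if $Y$ is another proper CAT(0) space which is quasi-isometric to $X$, then $\partial_cX$ and $\partial_cY$ (each with its direct limit topology) are homeomorphic.
   Context: A metric space is proper if its closed balls are compact. For a geodesic (isometrically embedded interval) $\gamma$ in a CAT(0) space, $\pi_\gamma$ denotes nearest point projection onto $\gamma$. For a constant $D>0$, $\gamma$ is $D$-contracting if for all $x,y\in X$, $d(x,y)<d(x,\pi_\gamma(x))$ implies $d(\pi_\gamma(x),\pi_\gamma(y))<D$; it is contracting if it is $D$-contracting for some $D$. Two geodesic rays are asymptotic if they stay at bounded distance; the visual boundary $\partial X$ is the set of asymptoty classes of geodesic rays, the class of $\gamma$ is denoted $\gamma(\infty)$, and for a bi-infinite geodesic $\gamma(-\infty)$ denotes the class of $t\mapsto\gamma(-t)$, $t\ge0$. In a complete CAT(0) space each class has a unique representative starting at a given base point $x_0$. The cone topology on $\partial X$ has as neighborhood basis of $\gamma(\infty)$ (with $\gamma(0)=x_0$) the sets $U(\gamma,r,\epsilon)=\{\alpha(\infty): \alpha(0)=x_0,\ d(\alpha(t),\gamma(t))<\epsilon\ \forall t<r\}$. The contracting boundary is $\partial_cX=\{\alpha(\infty)\in\partial X:\alpha \text{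 contracting}\}$. For $n\in\mathbb{N}$, $\partial_c^nX_{x_0}\subset\partial X$ is the set of points represented by an $n$-contracting ray starting at $x_0$, with the subspace topology from the cone topology. The direct limit topology on $\partial_cX=\bigcup_n\partial^n_cX_{x_0}=\varinjlim\partial_c^nX_{x_0}$ is the one in which $V$ is closed (open) iff $V\cap\partial_c^nX_{x_0}$ is closed (open) in $\partial_c^nX_{x_0}$ for all $n$; it does not depend on $x_0$. A space is $\sigma$-compact if it is a countable union of compact subspaces. A $(K,L)$-quasi-isometry $f:X\to Y$ is a map with $\frac1Kd(s,t)-L\le d(f(s),f(t))\le Kd(s,t)+L$ for all $s,t\in X$ and such that every $y\in Y$ is within distance less than $L$ of $f(X)$. *)

(* Defs.v *)
From HB Require Import structures.
From mathcomp Require Import all_boot all_order all_algebra.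
From mathcomp Require Import generic_quotient.
From mathcomp Require Import all_classical all_reals all_analysis.
Set Implicit Arguments.
Unset Strict Implicit.
Unset Printing Implicit Defensive.
Import Order.TTheory GRing.Theory Num.Theory.
Local Open Scope classical_set_scope.
Local Open Scope ring_scope.

Section Geodesics.
Context {R : realType}.

Definition proper_space (X : metricType R) :=
  forall (x : X) (r : R), compact [set y | mdist x y <= r].

(* A geodesic defined on the interval I is stored as a total map R -> X; its
   values outside I are irrelevant and are never used below. *)
Record geodesic (I : interval R) (X : metricType R) := Geodesic {
  geodesic_fun :> R -> X;
  geodesic_isometric : forall s t, s \in I -> t \in I ->
    mdist (geodesic_fun s) (geodesic_fun t) = `|s - t| }.

Definition ray (X : metricType R) := geodesic `[0, +oo[ X.
Definition line (X : metricType R) := geodesic `]-oo, +oo[ X.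

HB.instance Definition _ (X : metricType R) := gen_eqMixin (ray X).
HB.instance Definition _ (X : metricType R) := gen_choiceMixin (ray X).

Definition geodesic_segment (X : metricType R) (x y : X)
    (c : geodesic `[0, mdist x y] X) :=
  c 0 = x /\ c (mdist x y) = y.

Definition geodesic_space (X : metricType R) :=
  forall x y : X, exists c : geodesic `[0, mdist x y] X, geodesic_segment c.

(* The norm of 'rV[R]_2 in the library is the sup norm. *)
Definition euclidean_dist (p q : 'rV[R]_2) : R :=
  Num.sqrt (\sum_(k < 2) (p 0 k - q 0 k) ^+ 2).

(* The vertices of a geodesic triangle are v 0, v 1, v 2 and its i-th side goes
   from v i to v (i + 1), with indices modulo 3; u is a comparison triangle.
   A point of the i-th side has the form s i (a * l), where l is the length
   of that side and 0 <= a <= 1; its comparison point is then the point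
   dividing the segment from u i to u (i + 1) in the same ratio. *)
Definition CAT0 (X : metricType R) :=
  geodesic_space X /\
  forall (v : 'I_3 -> X)
    (s : forall i : 'I_3, geodesic `[0, mdist (v i) (v (i + 1))] X)
    (u : 'I_3 -> 'rV[R]_2),
  (forall i, geodesic_segment (s i)) ->
  (forall i, euclidean_dist (u i) (u (i + 1)) = mdist (v i) (v (i + 1))) ->
  forall (i j : 'I_3) (a b : R), 0 <= a <= 1 -> 0 <= b <= 1 ->
  mdist (s i (a * mdist (v i) (v (i + 1))))
        (s j (b * mdist (v j) (v (j + 1))))
    <= euclidean_dist ((1 - a) *: u i + a *: u (i + 1))
                      ((1 - b) *: u j + b *: u (j + 1)).

Definition nearest_points (X : metricType R) (A : set X) (x : X) : set X :=
  [set p | A p /\ forall q, A q -> mdist x p <= mdist x q].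

(* In a proper CAT(0) space the image of a geodesic defined on a closed interval
   is closed and convex, so there is exactly one nearest point and the default
   value x is never used. *)
Definition proj (I : interval R) (X : metricType R) (c : geodesic I X) (x : X)
  : X := xget x (nearest_points (c @` [set` I]) x).

Definition contracting_with (D : R) (I : interval R) (X : metricType R)
    (c : geodesic I X) :=
  0 < D /\
  forall x y : X, mdist x y < mdist x (proj c x) ->
    mdist (proj c x) (proj c y) < D.

Definition contracting (I : interval R) (X : metricType R)
    (c : geodesic I X) :=
  exists D : R, contracting_with D c.

Section Boundary.
Variable X : metricType R.

Definition asymptotic (c c' : ray X) : bool :=
  `[< exists M : R, forall t : R, 0 <= t -> mdist (c t) (c' t) <= M >].

Lemma asymptotic_refl : reflexive asymptotic.
Proof. by move=> c; apply/asboolP; exists 0 => t _; rewrite mdistxx. Qed.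

Lemma asymptotic_sym : symmetric asymptotic.
Proof.
move=> c c'; apply: asbool_equiv_eq; split=> -[M cM]; exists M => t t0.
  by rewrite metric_sym cM.
by rewrite metric_sym cM.
Qed.

Lemma asymptotic_trans : transitive asymptotic.
Proof.
move=> c2 c1 c3 /asboolP[M cM] /asboolP[N cN]; apply/asboolP; exists (M + N).
by move=> t t0; rewrite (le_trans (metric_triangle _ (c2 t) _))// lerD ?cM ?cN.
Qed.

Canonical asymptotic_equiv :=
  EquivRel asymptotic asymptotic_refl asymptotic_sym asymptotic_trans.

Definition visual_boundary := {eq_quot asymptotic}%qT.

HB.instance Definition _ := Choice.on visual_boundary.

Definition endpoint (c : ray X) : visual_boundary :=
  (\pi_({eq_quot asymptotic}) c)%qT.

Lemma line_pos_subproof (g : line X) (s t : R) :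
  s \in `[0, +oo[ -> t \in `[0, +oo[ -> mdist (g s) (g t) = `|s - t|.
Proof. by move=> _ _; rewrite geodesic_isometric. Qed.

Lemma line_neg_subproof (g : line X) (s t : R) :
  s \in `[0, +oo[ -> t \in `[0, +oo[ ->
  mdist (g (- s)) (g (- t)) = `|s - t|.
Proof.
by move=> _ _; rewrite geodesic_isometric// opprK addrC distrC -opprB normrN distrC.
Qed.

Definition line_pos (g : line X) : ray X := Geodesic (line_pos_subproof g).
Definition line_neg (g : line X) : ray X := Geodesic (line_neg_subproof g).

Definition contracting_boundary : set visual_boundary :=
  [set xi | exists c : ray X, contracting c /\ endpoint c = xi].

Definition contracting_stage (x0 : X) (n : nat) : set visual_boundary :=
  [set xi | exists c : ray X,
     [/\ c 0 = x0, contracting_with n%:R c & endpoint c = xi]].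

Lemma contracting_stage_sub (x0 : X) (n : nat) :
  contracting_stage x0 n `<=` contracting_boundary.
Proof. by move=> xi [c [_ cn <-]]; exists c; split=> //; exists n%:R. Qed.

Definition visibility (A : set visual_boundary) :=
  forall xi eta, A xi -> A eta -> xi <> eta ->
  exists g : line X, endpoint (line_pos g) = xi /\ endpoint (line_neg g) = eta.

Section ConeTopology.
Variable x0 : X.

Definition cone_nbhs (c : ray X) (r e : R) : set visual_boundary :=
  [set xi | exists a : ray X,
     [/\ a 0 = x0, forall t, 0 <= t < r -> mdist (a t) (c t) < e
       & endpoint a = xi]].

Definition cone_open (A : set visual_boundary) :=
  forall c : ray X, c 0 = x0 -> A (endpoint c) ->
  exists r e : R, [/\ 0 < r, 0 < e & cone_nbhs c r e `<=` A].

Lemma cone_nbhsS (c : ray X) (r r' e e' : R) :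
  r' <= r -> e <= e' -> cone_nbhs c r e `<=` cone_nbhs c r' e'.
Proof.
move=> rr ee xi [a [a0 ac <-]]; exists a; split=> // t /andP[t0 tr].
by rewrite (lt_le_trans _ ee)// ac// t0 (lt_le_trans tr).
Qed.

Lemma cone_openT : cone_open setT.
Proof. by move=> c _ _; exists 1, 1; split. Qed.

Lemma cone_openI (A B : set visual_boundary) :
  cone_open A -> cone_open B -> cone_open (A `&` B).
Proof.
move=> oA oB c c0 [Ac Bc].
have [r [e [r0 e0 sA]]] := oA c c0 Ac.
have [r' [e' [r'0 e'0 sB]]] := oB c c0 Bc.
exists (Num.max r r'), (Num.min e e'); split.
- by rewrite lt_max r0.
- by rewrite lt_min e0.
- move=> xi cxi; split; [apply: sA | apply: sB]; apply: cone_nbhsS cxi.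
  + by rewrite le_max lexx.
  + by rewrite ge_min lexx.
  + by rewrite le_max lexx orbT.
  + by rewrite ge_min lexx orbT.
Qed.

Lemma cone_open_bigU (I : Type) (f : I -> set visual_boundary) :
  (forall i, cone_open (f i)) -> cone_open (\bigcup_i f i).
Proof.
move=> of_ c c0 [i _ fic]; have [r [e [r0 e0 s]]] := of_ i c c0 fic.
by exists r, e; split=> // xi /s fxi; exists i.
Qed.

End ConeTopology.

(* The carrier does not depend on x0; only the topology does. *)
Definition cone_boundary (x0 : X) : Type := visual_boundary.

HB.instance Definition _ (x0 : X) := Choice.on (cone_boundary x0).
HB.instance Definition _ (x0 : X) :=
  isOpenTopological.Build (cone_boundary x0)
    (@cone_openT x0) (@cone_openI x0) (@cone_open_bigU x0).

(* In subspace S, for S a set of points of the cone topology, the points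
   outside S are isolated; hence a subset of S is open in subspace S
   exactly when it is open for the subspace topology of S. *)
Definition stage_space (x0 : X) (n : nat) :=
  subspace (contracting_stage x0 n : set (cone_boundary x0)).

Definition limit_boundary (x0 : X) : Type := set_type contracting_boundary.

HB.instance Definition _ (x0 : X) := Choice.on (limit_boundary x0).

Definition limit_open (x0 : X) (V : set (limit_boundary x0)) :=
  forall n, open ((set_val @` V `&` contracting_stage x0 n)
                   : set (stage_space x0 n)).

Lemma limit_openT (x0 : X) : @limit_open x0 setT.
Proof.
move=> n; rewrite (_ : _ `&` _ = contracting_stage x0 n :> set visual_boundary).
  exact: open_subspaceT.
apply/seteqP; split=> [xi []//|xi Sxi]; split=> //.
by exists (SigSub (mem_set (contracting_stage_sub Sxi))).
Qed.

Lemma limit_openI (x0 : X) (A B : set (limit_boundary x0)) :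
  limit_open A -> limit_open B -> limit_open (A `&` B).
Proof.
move=> oA oB n; have := openI (oA n) (oB n); congr open.
apply/seteqP; split=> [xi [[[a Aa <-] Sa] [[b Bb ba] _]]|].
  by split=> //; exists a => //; split=> //; rewrite -(val_inj ba).
by move=> xi [[a [Aa Ba] <-] Sa]; split; split=> //; exists a.
Qed.

Lemma limit_open_bigU (x0 : X) (I : Type) (f : I -> set (limit_boundary x0)) :
  (forall i, limit_open (f i)) -> limit_open (\bigcup_i f i).
Proof.
move=> of_ n; have := bigcup_open (fun i (_ : setT i) => of_ i n); congr open.
apply/seteqP; split=> [xi [i _ [[a fa <-] Sa]]|xi [[a [i _ fa] <-] Sa]].
  by split=> //; exists a => //; exists i.
by exists i => //; split=> //; exists a.
Qed.

HB.instance Definition _ (x0 : X) :=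
  isOpenTopological.Build (limit_boundary x0)
    (@limit_openT x0) (@limit_openI x0) (@limit_open_bigU x0).

End Boundary.

(* 0 < K excludes the junk value 1 / 0 = 0 and bounded spaces for K < 0. *)
Definition quasi_isometry (X Y : metricType R) (K L : R) (f : X -> Y) :=
  [/\ 0 < K,
      forall s t : X, K^-1 * mdist s t - L <= mdist (f s) (f t)
                      /\ mdist (f s) (f t) <= K * mdist s t + L
    & forall y : Y, exists x : X, mdist y (f x) < L].

Definition quasi_isometric (X Y : metricType R) :=
  exists (K L : R) (f : X -> Y), quasi_isometry K L f.

End Geodesics.

Arguments contracting_boundary {R} X _.

Definition sigma_compact (T : topologicalType) :=
  exists K : nat -> set T, (forall n, compact (K n)) /\ \bigcup_n K n = setT.

Definition homeomorphic (S T : topologicalType) :=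
  exists (f : S -> T) (g : T -> S),
    [/\ cancel f g, cancel g f, continuous f & continuous g].

(* Main.v *)
Require Import Defs.
From mathcomp Require Import all_boot all_order all_algebra.
From mathcomp Require Import all_classical all_reals all_analysis.
From mathcomp Require Import ring lra.
(* all_analysis also defines a proj. *)
Import Defs.
Set Implicit Arguments.
Unset Strict Implicit.
Unset Printing Implicit Defensive.
Import Order.TTheory GRing.Theory Num.Theory.
Import numFieldNormedType.Exports.
Local Open Scope classical_set_scope.
Local Open Scope ring_scope.

(** All the CAT(0) geometry comes from the CN inequality.

    Let g be a coarse inverse of a quasi-isometry f : X -> Y and c a D-contracting
    ray of X.  A path that stays far from c moves its projection to c by at most
    D per long step.  Hence the images under g of the segments from y0 to f (c n)
    stay near c, and these segments have an ultralimit c', a ray that fellow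
    travels f o c.  The same count of steps, applied to the images under g of
    short paths in Y avoiding a neighbourhood of c', shows that every segment
    from y to a point of c' passes near the projection q of y; convexity of balls
    then makes c' contracting, with constants depending only on D.  So f induces a
    map of contracting boundaries that respects the stages, and it is
    continuous because in a CAT(0) space two rays from the same point that are
    close at a large time are very close at earlier times.

    The case f = g = id moves base points and gives the segments needed for
    visibility: if a is contracting, all segments from b t to a s pass near the
    common origin of a and b, so they have an ultralimit.  Finally an ultralimit of
    n-contracting rays satisfies the contraction inequality with <= n, so it is
    (n+1)-contracting; the stages with <= n are compact and cover the boundary. *)

(** * CAT(0) comparison *)

Section Comparison.
Context {R : realType}.

Lemma forall_ord3 (P : 'I_3 -> Prop) :
  P 0 -> P 1 -> P (1 + 1) -> forall i, P i.
Proof.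
move=> P0 P1 P2 [[|[|[|//]]] h].
- by rewrite (_ : Ordinal h = 0)//; apply/val_inj.
- by rewrite (_ : Ordinal h = 1)//; apply/val_inj.
- by rewrite (_ : Ordinal h = 1 + 1)//; apply/val_inj.
Qed.

Definition ord3_case (T : Type) (x y z : T) (i : 'I_3) : T :=
  match val i with 0 => x | 1 => y | _ => z end.

Definition vec2 (a b : R) : 'rV[R]_2 := \row_(k < 2) if k == 0 then a else b.

Lemma euclidean_dist_vec2 (a b c d : R) :
  euclidean_dist (vec2 a b) (vec2 c d)
  = Num.sqrt ((a - c) ^+ 2 + (b - d) ^+ 2).
Proof. by rewrite /euclidean_dist big_ord_recl big_ord1 !mxE. Qed.

Lemma vec2_combination (t a b c d : R) :
  (1 - t) *: vec2 a b + t *: vec2 c d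
  = vec2 ((1 - t) * a + t * c) ((1 - t) * b + t * d).
Proof. by apply/rowP => k; rewrite !mxE; case: ifP. Qed.

(* The vertices are put at (0, 0), (A, 0) and (x, y); the law of cosines
   gives x. *)
Lemma comparison_triangle (A B C : R) :
  0 <= A -> 0 <= B -> 0 <= C -> A <= B + C -> B <= A + C -> C <= A + B ->
  exists x y : R, [/\ x ^+ 2 + y ^+ 2 = C ^+ 2 &
                      (A - x) ^+ 2 + y ^+ 2 = B ^+ 2].
Proof.
move=> A0 B0 C0 hA hB hC.
have [A_eq0|A_neq0] := eqVneq A 0.
  exists C, 0; split; first by ring.
  have -> : B = C by lra.
  by rewrite A_eq0; ring.
pose x := (A ^+ 2 + C ^+ 2 - B ^+ 2) / (2 * A).
have xA : 2 * A * x = A ^+ 2 + C ^+ 2 - B ^+ 2.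
  by rewrite /x mulrC divfK// mulf_neq0.
have Ap : 0 < A by rewrite lt_neqAle eq_sym A_neq0.
have x_le : x ^+ 2 <= C ^+ 2.
  suff : (2 * A * x) ^+ 2 <= (2 * A * C) ^+ 2.
    by rewrite !exprMn ler_pM2l// mulr_gt0// exprn_gt0.
  rewrite -subr_ge0 subr_sqr xA.
  by rewrite mulr_ge0//; nra.
exists x, (Num.sqrt (C ^+ 2 - x ^+ 2)).
by rewrite sqr_sqrtr ?subr_ge0//; split; lra.
Qed.

End Comparison.

(** * Segments and the CN inequality *)

Section CN.
Context {R : realType} {X : metricType R}.
Implicit Types (x y z w : X).

(** A shortfall on any subinterval would bring the ends closer than [l]. *)
Lemma lipschitz_isometric (c : R -> X) (l : R) :
  (forall s t, 0 <= s -> s <= t -> t <= l -> mdist (c s) (c t) <= t - s) ->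
  l <= mdist (c 0) (c l) ->
  forall s t, s \in `[0, l] -> t \in `[0, l] ->
  mdist (c s) (c t) = `|s - t|.
Proof.
move=> c_lip cl.
have H s t : 0 <= s -> s <= t -> t <= l -> mdist (c s) (c t) = t - s.
  move=> s0 st tl; apply/eqP; rewrite eq_le c_lip//=.
  have := metric_triangle (c 0) (c s) (c l).
  have := metric_triangle (c s) (c t) (c l).
  have := c_lip 0 s (lexx _) s0 (le_trans st tl).
  have := c_lip t l (le_trans s0 st) tl (lexx _).
  by lra.
move=> s t; rewrite !in_itv/= => /andP[s0 sl] /andP[t0 tl].
have [st|ts] := leP s t; first by rewrite H// distrC ger0_norm// subr_ge0.
by rewrite metric_sym H// ?(ltW ts)// ger0_norm// subr_ge0 ltW.
Qed.

(** A plain map: the type of a [geodesic] contains its interval, which hampers gluing and rewriting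
    of endpoints. *)
Definition segment_map x y (c : R -> X) :=
  [/\ c 0 = x, c (mdist x y) = y &
      forall s t, s \in `[0, mdist x y] -> t \in `[0, mdist x y] ->
      mdist (c s) (c t) = `|s - t|].

Lemma segment_exists : geodesic_space X ->
  forall x y, exists c, segment_map x y c.
Proof.
by move=> gX x y; have [c [c0 c1]] := gX x y; exists c; split=> // s t hs ht;
  rewrite geodesic_isometric.
Qed.

Lemma segment_through : geodesic_space X -> forall x y w,
  mdist x w + mdist w y = mdist x y ->
  exists c, segment_map x y c /\ c (mdist x w) = w.
Proof.
move=> gX x y w xwy.
have [c1 [c10 c11 c1i]] := segment_exists gX x w.
have [c2 [c20 c21 c2i]] := segment_exists gX w y.
pose c t := if t <= mdist x w then c1 t else c2 (t - mdist x w).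
have c_w : c (mdist x w) = w by rewrite /c lexx.
have c_y : c (mdist x y) = y.
  rewrite /c -xwy gerDl; case: ifPn => [wy|_].
    have /mdist_positivity <- : mdist w y = 0.
      by apply/eqP; rewrite eq_le wy mdist_ge0.
    by rewrite mdistxx addr0 c11.
  by rewrite addrAC subrr add0r.
have c_x : c 0 = x by rewrite /c mdist_ge0.
exists c; split=> //; split=> //.
have xw0 := mdist_ge0 x w; have wy0 := mdist_ge0 w y.
apply: lipschitz_isometric => [s t s0 st tl|]; last by rewrite c_x c_y.
have c1d r : 0 <= r -> r <= mdist x w -> mdist (c1 r) w = mdist x w - r.
  move=> r0 rw; rewrite -[X in mdist _ X]c11 c1i ?in_itv/= ?lexx ?r0 ?rw ?mdist_ge0//.
  by rewrite distrC ger0_norm// subr_ge0.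
have c2d : forall r, 0 <= r -> r <= mdist w y -> mdist w (c2 r) = r.
  move=> r r0 rw; rewrite -[X in mdist X]c20 c2i ?in_itv/= ?lexx ?r0 ?rw ?mdist_ge0//.
  by rewrite sub0r normrN ger0_norm.
rewrite /c; case: (leP t) => tw.
  rewrite (le_trans st tw) c1i ?in_itv/= ?s0 ?(le_trans st tw) ?(le_trans s0 st)//.
  by rewrite distrC ger0_norm// subr_ge0.
case: (leP s) => sw.
  rewrite (le_trans (metric_triangle _ w _))// c1d// c2d//; lra.
rewrite c2i ?in_itv/=; last 2 first.
- by apply/andP; split; lra.
- by apply/andP; split; lra.
by rewrite distrC ger0_norm; lra.
Qed.

Lemma cat0_comparison : CAT0 X ->
  forall (v : 'I_3 -> X) (S : 'I_3 -> R -> X) (u : 'I_3 -> 'rV[R]_2),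
  (forall i, segment_map (v i) (v (i + 1)) (S i)) ->
  (forall i, euclidean_dist (u i) (u (i + 1)) = mdist (v i) (v (i + 1))) ->
  forall (i j : 'I_3) (a b : R), 0 <= a <= 1 -> 0 <= b <= 1 ->
  mdist (S i (a * mdist (v i) (v (i + 1))))
        (S j (b * mdist (v j) (v (j + 1))))
    <= euclidean_dist ((1 - a) *: u i + a *: u (i + 1))
                      ((1 - b) *: u j + b *: u (j + 1)).
Proof.
move=> [_ catX] v S u Sseg uv i j a b a01 b01.
have iso k : forall s t, s \in `[0, mdist (v k) (v (k + 1))] ->
    t \in `[0, mdist (v k) (v (k + 1))] ->
    mdist (S k s) (S k t) = `|s - t| by case: (Sseg k).
by apply: (catX v (fun k => Geodesic (@iso k)) u _ uv) => // k;
  case: (Sseg k).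
Qed.

(** The right-hand side is Stewart's formula in the comparison triangle. A geodesic through [w]
    makes [w] a point of a side. *)
Lemma cat0_CN : CAT0 X -> forall x y z w (a : R), 0 <= a <= 1 ->
  mdist y w = a * mdist y z -> mdist w z = (1 - a) * mdist y z ->
  mdist x w ^+ 2 <= (1 - a) * mdist x y ^+ 2 + a * mdist x z ^+ 2
                    - a * (1 - a) * mdist y z ^+ 2.
Proof.
move=> catX x y z w a a01 yw wz.
have gX := catX.1.
have [|c0 [c0seg c0w]] := @segment_through gX y z w; first by rewrite yw wz; lra.
have [c1 c1seg] := segment_exists gX z x.
have [c2 c2seg] := segment_exists gX x y.
have [p [q [hC hB]]] : exists p q : R, [/\ p ^+ 2 + q ^+ 2 = mdist x y ^+ 2 &
    (mdist y z - p) ^+ 2 + q ^+ 2 = mdist z x ^+ 2].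
  have := metric_triangle y x z; have := metric_triangle z y x.
  have := metric_triangle x z y.
  rewrite (metric_sym y x) (metric_sym x z) (metric_sym z y) => h1 h2 h3.
  by apply: comparison_triangle; rewrite ?mdist_ge0//; lra.
pose v := ord3_case y z x.
pose S := ord3_case c0 c1 c2.
pose u := ord3_case (vec2 0 0) (vec2 (mdist y z) 0) (vec2 p q).
have Sseg i : segment_map (v i) (v (i + 1)) (S i).
  by move: i; apply: forall_ord3.
have uv i : euclidean_dist (u i) (u (i + 1)) = mdist (v i) (v (i + 1)).
  move: i; apply: forall_ord3; rewrite /u /v /=/ord3_case/= euclidean_dist_vec2.
  - by rewrite subrr !sub0r sqrrN expr0n addr0 sqrtr_sqr ger0_norm ?mdist_ge0.
  - by rewrite sub0r sqrrN hB sqrtr_sqr ger0_norm ?mdist_ge0.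
  - by rewrite !subr0 hC sqrtr_sqr ger0_norm ?mdist_ge0.
have b01 : 0 <= (1 : R) <= 1 by rewrite ler01 lexx.
(* Side 0 carries [w]; ratio 1 on side 1 gives the opposite vertex [x]. *)
have := cat0_comparison catX Sseg uv 0 1 a01 b01.
rewrite /u /v /S /ord3_case/= mul1r -yw c0w.
have [_ -> _] := c1seg.
rewrite !vec2_combination euclidean_dist_vec2 => h.
rewrite metric_sym (le_trans (lerXn2r 2 _ _ h)) ?nnegrE ?mdist_ge0 ?sqrtr_ge0//.
rewrite sqr_sqrtr ?addr_ge0 ?sqr_ge0// (metric_sym x z) -hC -hB.
by rewrite le_eqVlt; apply/orP; left; apply/eqP; ring.
Qed.

End CN.

(** * Rays and ultralimits *)

Section Rays.
Context {R : realType} {X : metricType R}.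
Implicit Types (x y z w : X) (a b c : ray X).

Lemma ray_mdist c s t : 0 <= s -> 0 <= t -> mdist (c s) (c t) = `|s - t|.
Proof. by move=> s0 t0; rewrite geodesic_isometric// in_itv/= ?s0 ?t0. Qed.

Lemma ray_mdist0 c t : 0 <= t -> mdist (c 0) (c t) = t.
Proof. by move=> t0; rewrite ray_mdist// sub0r normrN ger0_norm. Qed.

Lemma ray_mdist_le c s t : 0 <= s -> s <= t -> mdist (c s) (c t) = t - s.
Proof.
move=> s0 st; rewrite ray_mdist ?(le_trans s0 st)//.
by rewrite distrC ger0_norm// subr_ge0.
Qed.

Lemma ray_param_le a b s t : 0 <= s -> 0 <= t ->
  `|s - t| <= mdist (a 0) (b 0) + mdist (a s) (b t).
Proof.
move=> s0 t0; have as_ := ray_mdist0 a s0; have bt := ray_mdist0 b t0.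
have h1 := metric_triangle (a 0) (b 0) (a s).
have h2 := metric_triangle (b 0) (b t) (a s).
have h3 := metric_triangle (b 0) (a 0) (b t).
have h4 := metric_triangle (a 0) (a s) (b t).
rewrite ler_norml; rewrite (metric_sym (b 0) (a 0)) in h3.
by rewrite (metric_sym (b t) (a s)) in h2; apply/andP; split; lra.
Qed.

Lemma close_ray_same_time a b s t : 0 <= s -> 0 <= t ->
  mdist (a s) (b s) <= mdist (a 0) (b 0) + 2 * mdist (a s) (b t).
Proof.
move=> s0 t0; have := ray_param_le a b s0 t0.
have := metric_triangle (a s) (b t) (b s).
by rewrite (ray_mdist b t0 s0) distrC; lra.
Qed.

Lemma proj_nearest c x : nearest_points (c @` [set` `[0, +oo[]) x !=set0 ->
  (exists2 s, 0 <= s & proj c x = c s) /\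
  forall t, 0 <= t -> mdist x (proj c x) <= mdist x (c t).
Proof.
move=> [p hp]; have : nearest_points (c @` [set` `[0, +oo[]) x (proj c x).
  exact: xgetI hp.
move=> [[s /= s0 sp] h]; split.
  by exists s => //; move: s0; rewrite in_itv/= andbT.
by move=> t t0; apply: h; exists t => //=; rewrite in_itv/= t0.
Qed.

(* EVT on [0, 2 d(x, c 0)], outside of which c is farther from x than c 0. *)
Lemma nearest_points_ray c x :
  nearest_points (c @` [set` `[0, +oo[]) x !=set0.
Proof.
(* The values of [c] at negative times are arbitrary; clamping makes [h] continuous everywhere. *)
pose h t := mdist x (c (Num.max 0 t)).
have h_lip s t : `|h s - h t| <= `|s - t|.
  have m0 u : 0 <= Num.max 0 u :> R by rewrite le_max lexx.
  apply: (@le_trans _ _ `|Num.max 0 s - Num.max 0 t|).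
    rewrite -(ray_mdist c) ?m0// /h ler_norml.
    have := metric_triangle x (c (Num.max 0 s)) (c (Num.max 0 t)).
    have := metric_triangle x (c (Num.max 0 t)) (c (Num.max 0 s)).
    by rewrite (metric_sym (c (Num.max 0 t))) => ? ?; apply/andP; split; lra.
  rewrite ler_norml; case: (leP 0 s) => s0; case: (leP 0 t) => t0;
    have := ler_norm (s - t); have := ler_norm (t - s);
    rewrite (distrC t) => ? ?; apply/andP; split; lra.
have h_cont : continuous h.
  move=> s; apply/cvgrPdist_lt => e e0.
  near=> t; apply: (le_lt_trans (h_lip s t)).
  by near: t; apply: cvgr_dist_lt.
set N := 2 * mdist x (c 0) + 1.
have N0 : 0 <= N by rewrite addr_ge0// mulr_ge0// mdist_ge0.
have [s s_in smin] := @EVT_min _ h 0 N N0 (continuous_subspaceT h_cont).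
have s0 : 0 <= s by move: s_in; rewrite in_itv/= => /andP[].
exists (c s); split; first by exists s => //=; rewrite in_itv/= s0.
move=> q [t /=]; rewrite in_itv/= andbT => t0 <-.
have hE u : 0 <= u -> h u = mdist x (c u) by move=> u0; rewrite /h max_r.
have [tN|Nt] := leP t N.
  by have := smin t; rewrite !hE// in_itv/= t0 tN; apply.
apply: (@le_trans _ _ (mdist x (c 0))).
  by have := smin 0; rewrite !hE// in_itv/= lexx N0; apply.
have := metric_triangle (c 0) x (c t); rewrite (metric_sym (c 0) x) ray_mdist0//.
by move: Nt; rewrite /N; lra.
Unshelve. all: by end_near. Qed.

Lemma proj_ray c x : exists2 s, 0 <= s & proj c x = c s.
Proof. exact: (proj_nearest (nearest_points_ray c x)).1. Qed.

Lemma proj_ray_min c x t : 0 <= t -> mdist x (proj c x) <= mdist x (c t).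
Proof. exact: (proj_nearest (nearest_points_ray c x)).2. Qed.

Lemma proj_rayxx c t : 0 <= t -> proj c (c t) = c t.
Proof.
move=> t0; have := proj_ray_min c (c t) t0; rewrite mdistxx => h.
by apply/esym/mdist_positivity/eqP; rewrite eq_le h mdist_ge0.
Qed.

Lemma contracting_with_le D D' (I : interval R) (c : geodesic I X) : D <= D' ->
  contracting_with D c -> contracting_with D' c.
Proof.
move=> DD' [D0 h]; split; first exact: lt_le_trans DD'.
by move=> x y /h /lt_le_trans; apply.
Qed.

Lemma endpoint_eqP a b : (endpoint a = endpoint b) <->
  exists M : R, forall t : R, 0 <= t -> mdist (a t) (b t) <= M.
Proof.
split=> [/eqmodP /asboolP//|h].
by apply/eqmodP/asboolP.
Qed.

Hypothesis catX : CAT0 X.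

(** By CN the squared distance to [x] at [w] is at most a weighted mean of its values at [y] and
    [z]. *)
Lemma cat0_ball_convex x y z w r : mdist y w + mdist w z = mdist y z ->
  mdist x y <= r -> mdist x z <= r -> mdist x w <= r.
Proof.
move=> ywz xy xz.
have [yz0|yz0] := eqVneq (mdist y z) 0.
  have := mdist_ge0 y w; have := mdist_ge0 w z => ? ?.
  by have /mdist_positivity <- : mdist y w = 0 by lra.
have yz_gt0 : 0 < mdist y z by rewrite lt_neqAle eq_sym yz0 mdist_ge0.
pose t := mdist y w / mdist y z.
have tE : mdist y w = t * mdist y z by rewrite /t divfK.
have t01 : 0 <= t <= 1.
  rewrite /t divr_ge0 ?mdist_ge0//= ler_pdivrMr// mul1r -ywz lerDl.
  by rewrite mdist_ge0.
have tE' : mdist w z = (1 - t) * mdist y z by lra.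
have := cat0_CN catX x t01 tE tE'.
have r0 : 0 <= r by rewrite (le_trans _ xy)// mdist_ge0.
have xy2 : mdist x y ^+ 2 <= r ^+ 2 by rewrite ler_sqr ?nnegrE ?mdist_ge0.
have xz2 : mdist x z ^+ 2 <= r ^+ 2 by rewrite ler_sqr ?nnegrE ?mdist_ge0.
move=> h; rewrite -ler_sqr ?nnegrE ?mdist_ge0//; move: h t01 => h /andP[t0 t1].
have : t * (1 - t) * mdist y z ^+ 2 >= 0.
  by rewrite mulr_ge0 ?sqr_ge0// mulr_ge0 ?subr_ge0.
have := ler_wpM2l t0 xz2.
have : (1 - t) * mdist x y ^+ 2 <= (1 - t) * r ^+ 2.
  by rewrite ler_wpM2l ?subr_ge0.
lra.
Qed.

(** CN is used for [p'] against [o, q] and for [q] against [o, p]; on combining, the distances from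
    [o] cancel. *)
Lemma cat0_thales (o p q p' q' : X) (t : R) : 0 <= t <= 1 ->
  mdist o p' = t * mdist o p -> mdist p' p = (1 - t) * mdist o p ->
  mdist o q' = t * mdist o q -> mdist q' q = (1 - t) * mdist o q ->
  mdist p' q' <= t * mdist p q.
Proof.
move=> t01 op p'p oq q'q; have /andP[t0 t1] := t01.
have := cat0_CN catX p' t01 oq q'q.
have := cat0_CN catX q t01 op p'p.
rewrite (metric_sym q p') (metric_sym q o) (metric_sym q p) (metric_sym p' o) op.
move=> /(ler_wpM2l t0) h1 h2.
rewrite -ler_sqr ?nnegrE ?mulr_ge0 ?mdist_ge0//.
by apply: (le_trans h2); move: h1; rewrite exprMn -subr_ge0 => h1;
  rewrite exprMn -subr_ge0; apply: (le_trans h1);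
  rewrite le_eqVlt; apply/orP; left; apply/eqP; ring.
Qed.

Lemma cat0_rays_converge a b t u : a 0 = b 0 -> 0 <= t -> t <= u ->
  mdist (a t) (b t) * u <= t * mdist (a u) (b u).
Proof.
move=> ab t0 tu.
have u0 := le_trans t0 tu.
have [u_eq0|u_neq0] := eqVneq u 0.
  have -> : t = 0 by lra.
  by rewrite u_eq0 mulr0 mul0r.
have u_gt0 : 0 < u by rewrite lt_neqAle eq_sym u_neq0.
have tuu : t / u * u = t by rewrite divfK.
have /(@cat0_thales (a 0) (a u) (b u) (a t) (b t)) : 0 <= t / u <= 1.
  by rewrite divr_ge0//= ler_pdivrMr// mul1r.
rewrite !ray_mdist_le// ab !ray_mdist_le// !subr0 mulrBl tuu mul1r.
move=> /(_ erefl erefl erefl erefl) /(ler_wpM2r u0) /le_trans; apply.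
by rewrite mulrAC tuu.
Qed.

Lemma cat0_rays_close a b t u v (C : R) : a 0 = b 0 -> 0 <= t -> t <= u ->
  0 <= v -> mdist (a u) (b v) <= C -> mdist (a t) (b t) * u <= t * (2 * C).
Proof.
move=> ab t0 tu v0 h; apply: (le_trans (cat0_rays_converge ab t0 tu)).
apply: ler_wpM2l => //.
have := close_ray_same_time a b (le_trans t0 tu) v0.
rewrite ab mdistxx; lra.
Qed.

Lemma cat0_rays_eq a b (C : R) : a 0 = b 0 ->
  (forall N, exists u v, [/\ N <= u, 0 <= v & mdist (a u) (b v) <= C]) ->
  forall t, 0 <= t -> a t = b t.
Proof.
move=> ab h t t0; apply/mdist_positivity/eqP; rewrite eq_le mdist_ge0 andbT.
apply/ler_addgt0Pl => e e0; rewrite addr0.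
(* The first summand gives [t <= u], the second makes the bound [2 * C * t / u] at most [e]. *)
have [u [v [Nu v0 uv]]] := h (t + t * (2 * C) / e).
have C0 : 0 <= C by rewrite (le_trans _ uv)// mdist_ge0.
have tC0 : 0 <= t * (2 * C) by rewrite !mulr_ge0.
have tu : t <= u by rewrite (le_trans _ Nu)// lerDl divr_ge0// ltW.
have := cat0_rays_close ab t0 tu v0 uv => hh.
have [->|t_neq0] := eqVneq t 0; first by rewrite ab mdistxx ltW.
have u_gt0 : 0 < u by rewrite (lt_le_trans _ tu)// lt_neqAle eq_sym t_neq0.
rewrite -(ler_pM2r u_gt0) (le_trans hh)// (mulrC e) -ler_pdivrMr//.
by rewrite (le_trans _ Nu)// lerDr.
Qed.

Lemma cat0_endpoint_inj a b : a 0 = b 0 -> endpoint a = endpoint b ->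
  forall t, 0 <= t -> a t = b t.
Proof.
move=> ab /endpoint_eqP[M h]; apply: (@cat0_rays_eq _ _ M) => // N.
have m0 : 0 <= Num.max 0 N by rewrite le_max lexx.
exists (Num.max 0 N), (Num.max 0 N); rewrite m0 h//; split=> //.
by rewrite le_max lexx orbT.
Qed.

(** By CN the midpoint of two distinct nearest points would be strictly closer to [x]. *)
Lemma cat0_nearest_unique c x s t : 0 <= s -> 0 <= t ->
  (forall u, 0 <= u -> mdist x (c s) <= mdist x (c u)) ->
  (forall u, 0 <= u -> mdist x (c t) <= mdist x (c u)) -> c s = c t.
Proof.
move=> s0 t0 hs ht.
have st : mdist x (c s) = mdist x (c t).
  by apply/eqP; rewrite eq_le hs//= ht.
pose m := (s + t) / 2.
have m0 : 0 <= m by rewrite divr_ge0 ?addr_ge0.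
have half01 : 0 <= (2^-1 : R) <= 1 by apply/andP; split; lra.
have /(cat0_CN catX x half01) CN : mdist (c s) (c m) = 2^-1 * mdist (c s) (c t).
  rewrite !ray_mdist// (_ : s - m = 2^-1 * (s - t)); last by rewrite /m; lra.
  by rewrite normrM ger0_norm//; lra.
have /CN {CN}: mdist (c m) (c t) = (1 - 2^-1) * mdist (c s) (c t).
  rewrite !ray_mdist// (_ : m - t = 2^-1 * (s - t)); last by rewrite /m; lra.
  by rewrite normrM ger0_norm; lra.
have : mdist x (c s) ^+ 2 <= mdist x (c m) ^+ 2.
  by rewrite ler_sqr ?nnegrE ?mdist_ge0// hs.
rewrite -st => h1 h2.
have : mdist (c s) (c t) ^+ 2 <= 0 by lra.
rewrite le_eqVlt ltNge sqr_ge0 orbF sqrf_eq0 => /eqP.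
exact: mdist_positivity.
Qed.

End Rays.

(** * Ultralimits of points and geodesics in proper spaces *)

Section Ultralimits.
Context {R : realType} {X : metricType R}.
Hypothesis properX : proper_space X.
Context {T : Type} {U : set_system T}.
Hypothesis ultraU : UltraFilter U.

Let properU : ProperFilter U. Proof. exact: ultra_proper. Qed.

Lemma ultralimit_point (h : T -> X) (x0 : X) (B : R) :
  (\forall i \near U, mdist x0 (h i) <= B) ->
  exists x, forall e, 0 < e -> \forall i \near U, mdist (h i) x < e.
Proof.
move=> hB.
pose V : set_system X := h @ U.
have fV : ProperFilter V by exact: fmap_proper_filter.
have VB : V [set y | mdist x0 y <= B] by [].
have [x [_ clx]] := properX fV VB.
exists x => e e0.
have [//|Uc] := in_ultra_setVsetC [set i | mdist (h i) x < e] ultraU.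
have [] := clx [set y | ~ mdist y x < e] [set y | mdist y x < e].
- exact: Uc.
- apply/metricType_numDomainType.nbhs_mdistP; exists e => //= y /=.
  by rewrite metric_sym.
- by move=> y [].
Qed.

(** A bound at time [s0] bounds all other times, so pointwise limits exist and distances pass to
    them. Isometry is asked only eventually for each pair of times, which covers segments of growing
    length. *)
Lemma ultralimit_geodesic (I : interval R) (c : T -> R -> X) (x0 : X) (B s0 : R) :
  s0 \in I ->
  (forall s t, s \in I -> t \in I ->
    \forall i \near U, mdist (c i s) (c i t) = `|s - t|) ->
  (\forall i \near U, mdist x0 (c i s0) <= B) ->
  exists g : geodesic I X, forall s, s \in I ->
    forall e, 0 < e -> \forall i \near U, mdist (c i s) (g s) < e.
Proof.
move=> s0I ciso cB.
have /choice[g hg] : forall s, exists x, s \in I ->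
    forall e, 0 < e -> \forall i \near U, mdist (c i s) x < e.
  move=> s; have [sI|sI] := boolP (s \in I); last by exists x0.
  have [|x hx] := @ultralimit_point (c ^~ s) x0 (B + `|s0 - s|); last by exists x.
  near=> i; rewrite (le_trans (metric_triangle _ (c i s0) _))//.
  rewrite lerD//; first by near: i.
  by rewrite le_eqVlt; apply/orP; left; apply/eqP; near: i; exact: ciso.
suff giso s t : s \in I -> t \in I -> mdist (g s) (g t) = `|s - t|.
  by exists (Geodesic giso).
move=> sI tI; apply/eqP; rewrite -subr_eq0 -normr_le0.
apply/ler_addgt0Pl => e e0; rewrite addr0.
have e20 : 0 < e / 2 by rewrite divr_gt0.
near U => i.
have h1 : mdist (c i s) (g s) < e / 2 by near: i; exact: hg.
have h2 : mdist (c i t) (g t) < e / 2 by near: i; exact: hg.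
have <- : mdist (c i s) (c i t) = `|s - t| by near: i; exact: ciso.
have := metric_triangle (g s) (c i s) (g t).
have := metric_triangle (c i s) (c i t) (g t).
have := metric_triangle (c i s) (g s) (c i t).
have := metric_triangle (g s) (g t) (c i t).
rewrite (metric_sym (g s) (c i s)) (metric_sym (g t) (c i t)) ler_norml.
by move=> *; apply/andP; split; lra.
Unshelve. all: by end_near. Qed.

End Ultralimits.

Lemma nonprincipal_ultrafilter : exists U : set_system nat,
  UltraFilter U /\ forall N, \forall n \near U, (N <= n)%N.
Proof.
have [U [UU sub]] := @ultraFilterLemma nat \oo _.
by exists U; split=> // N; apply: sub; exact: nbhs_infty_ge.
Qed.

Lemma natr_cofinal {R : realType} (M : R) :
  exists N, forall n, (N <= n)%N -> M <= n%:R.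
Proof.
exists (Num.bound `|M|) => n Nn.
rewrite (le_trans (ler_norm M))// (le_trans (ltW (archi_boundP (normr_ge0 M))))//.
by rewrite ler_nat.
Qed.

(** * Quasi-geodesics near contracting rays *)

Section QuasiGeodesics.
Context {R : realType} {X : metricType R}.

Definition coarse_lipschitz (K L l : R) (p : R -> X) := forall u v,
  0 <= u <= l -> 0 <= v <= l -> mdist (p u) (p v) <= K * `|u - v| + L.

Lemma coarse_lipschitz_rev K L l p : coarse_lipschitz K L l p ->
  coarse_lipschitz K L l (fun t => p (l - t)).
Proof.
move=> h u v /andP[u0 ul] /andP[v0 vl].
rewrite (_ : u - v = (l - v) - (l - u)); last by ring.
by rewrite distrC; apply: h; apply/andP; split; lra.
Qed.

(* Walking back from t0 by steps of length tau, as long as p stays farther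
   than A from c; each step moves the projection by less than D. *)
Lemma projection_walk (c : ray X) (D K L l tau A t0 : R) (p : R -> X) :
  contracting_with D c -> coarse_lipschitz K L l p ->
  0 <= K -> 0 < tau -> K * tau + L <= A -> 0 <= t0 <= l ->
  exists (k : nat) (s : R), [/\ 0 <= s <= t0,
    s = 0 \/ mdist (p s) (proj c (p s)) <= A,
    mdist (proj c (p s)) (proj c (p t0)) <= k%:R * D,
    k%:R * tau <= t0 - s + tau & t0 - s <= k%:R * tau].
Proof.
move=> [D0 contr] lip K0 tau0 KA /andP[t00 t0l].
have [n] : exists n : nat, t0 <= n%:R * tau.
  have [N hN] := natr_cofinal (t0 / tau).
  by exists N; rewrite -ler_pdivrMr// hN.
elim: n t0 t00 t0l => [|n IH] t0 t00 t0l ht0.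
  exists 0, 0; rewrite mul0r in ht0; have -> : t0 = 0 by lra.
  by rewrite mdistxx !mul0r lexx; split; [|left| | |] => //; lra.
have [near|far] := leP (mdist (p t0) (proj c (p t0))) A.
  by exists 0, t0; rewrite mdistxx !mul0r lexx t00; split; [|right| | |] => //; lra.
have step s : 0 <= s -> s <= t0 -> t0 - s <= tau ->
    mdist (proj c (p s)) (proj c (p t0)) <= D.
  move=> s0 st0 stau; rewrite metric_sym ltW// contr//.
  apply: le_lt_trans far; apply: le_trans KA.
  have /le_trans -> // : mdist (p t0) (p s) <= K * `|t0 - s| + L.
    by apply: lip; apply/andP; split; lra.
  by rewrite lerD2r ler_wpM2l// ger0_norm; lra.
(* A last step cut short at time 0 is counted in full, hence the extra [tau] in the bound on [k]. *)
have [t0tau|taut0] := leP t0 tau.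
  exists 1, 0; rewrite !mul1r lexx t00; split; [|left| | |] => //; try lra.
  by apply: step; lra.
have [||| k [s [/andP[s0 st] hs hD h1 h2]]] := IH (t0 - tau); try lra.
exists k.+1, s; rewrite -natr1; split=> //.
- by apply/andP; split; lra.
- have := step (t0 - tau); have := metric_triangle (proj c (p s))
    (proj c (p (t0 - tau))) (proj c (p t0)) => h3 /(_ _ _ _) h4.
  have : mdist (proj c (p (t0 - tau))) (proj c (p t0)) <= D by apply: h4; lra.
  lra.
- by lra.
- by lra.
Qed.

Lemma projection_walk_forward (c : ray X) (D K L l tau A t0 : R) (p : R -> X) :
  contracting_with D c -> coarse_lipschitz K L l p ->
  0 <= K -> 0 < tau -> K * tau + L <= A -> 0 <= t0 <= l ->
  exists (k : nat) (s : R), [/\ t0 <= s <= l,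
    s = l \/ mdist (p s) (proj c (p s)) <= A,
    mdist (proj c (p s)) (proj c (p t0)) <= k%:R * D,
    k%:R * tau <= s - t0 + tau & s - t0 <= k%:R * tau].
Proof.
move=> contr /coarse_lipschitz_rev lip K0 tau0 KA /andP[t00 t0l].
have lt0 : 0 <= l - t0 <= l by apply/andP; split; lra.
have [k [s [/andP[s0 st] hs hD h1 h2]]] :=
  projection_walk contr lip K0 tau0 KA lt0.
exists k, (l - s); rewrite (_ : l - (l - t0) = t0) in hD; last by ring.
split=> //; [by apply/andP; split; lra| |lra|lra].
by case: hs => [->|]; [left; rewrite subr0|right].
Qed.

(** The Morse lemma. Walking from [t] both ways until [p] is [A]-close to [c] takes time about
    [(k + k') * tau] but moves the projection by at most [(k + k') * D]; the lower bound on [p] then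
    limits the number of steps. *)
Lemma contracting_morse (D K L L' A0 : R) :
  0 < D -> 0 <= K -> 0 <= L -> 0 <= A0 ->
  exists M, forall (c : ray X) (p : R -> X) (l : R),
    contracting_with D c -> coarse_lipschitz K L l p ->
    (forall u v, 0 <= u <= l -> 0 <= v <= l ->
      `|u - v| <= K * mdist (p u) (p v) + L') ->
    mdist (p 0) (proj c (p 0)) <= A0 -> mdist (p l) (proj c (p l)) <= A0 ->
    forall t, 0 <= t <= l -> mdist (p t) (proj c (p t)) <= M.
Proof.
move=> D0 K0 L0 A00.
(* As [tau] exceeds [K * D] by 1, comparing time with displacement leaves [k + k' <= B]. *)
pose tau := K * D + 1; pose A := A0 + K * tau + L.
pose B := 2 * K * A + L' + 2 * tau.
exists (K * (B * tau) + L + A) => c p l contr lip low p0 pl t /andP[t0 tl].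
have tau0 : 0 < tau by rewrite ltr_wpDl// mulr_ge0// ltW.
have KA : K * tau + L <= A by rewrite /A; lra.
have A0A : A0 <= A by rewrite /A; have := mulr_ge0 K0 (ltW tau0); lra.
have tl' : 0 <= t <= l by rewrite t0.
have [k [s [/andP[s0 st] hs hD h1 h2]]] :=
  projection_walk contr lip K0 tau0 KA tl'.
have [k' [s' [/andP[ts' s'l] hs' hD' h1' h2']]] :=
  projection_walk_forward contr lip K0 tau0 KA tl'.
have {}hs : mdist (p s) (proj c (p s)) <= A.
  by case: hs => [->|//]; rewrite (le_trans p0).
have {}hs' : mdist (p s') (proj c (p s')) <= A.
  by case: hs' => [->|//]; rewrite (le_trans pl).
have ss' : mdist (p s) (p s') <= 2 * A + (k%:R + k'%:R) * D.
  have := metric_triangle (p s) (proj c (p s)) (p s').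
  have := metric_triangle (proj c (p s)) (proj c (p t)) (p s').
  have := metric_triangle (proj c (p t)) (proj c (p s')) (p s').
  by rewrite (metric_sym (proj c (p s')) (p s')) (metric_sym (proj c (p t)) (proj c (p s')));
    lra.
have s_in : 0 <= s <= l by apply/andP; split; lra.
have s'_in : 0 <= s' <= l by apply/andP; split; lra.
have := low s s' s_in s'_in; have := ler_wpM2l K0 ss'.
rewrite distrC ger0_norm; last by lra.
move=> h3 h4.
have kB : k%:R <= B.
  have : (k%:R + k'%:R) * tau <= K * (2 * A + (k%:R + k'%:R) * D) + L' + 2 * tau.
    by lra.
  by rewrite /B /tau => h5; have := ler0n R k'; lra.
have ts : t - s <= B * tau by rewrite (le_trans h2)// ler_wpM2r// ltW.
have [r r0 pr] := proj_ray c (p s).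
rewrite (le_trans (proj_ray_min c (p t) r0))// -pr.
rewrite (le_trans (metric_triangle _ (p s) _))// lerD//.
rewrite (le_trans (lip t s tl' s_in))// lerD2r ler_wpM2l// ger0_norm//.
by lra.
Qed.

End QuasiGeodesics.

(** Upper bounds with common constants make the notion symmetric; the lower bound on one map comes
    from the other, as in [coarse_expand]. *)
Record coarse_inverse {R : realType} {X Y : metricType R} (K L : R)
    (f : X -> Y) (g : Y -> X) : Prop := CoarseInverse {
  coarse_K : 0 <= K;
  coarse_L : 0 <= L;
  coarse_f : forall x x', mdist (f x) (f x') <= K * mdist x x' + L;
  coarse_g : forall y y', mdist (g y) (g y') <= K * mdist y y' + L;
  coarse_gf : forall x, mdist (g (f x)) x <= L;
  coarse_fg : forall y, mdist (f (g y)) y <= L }.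

Section CoarseInverses.
Context {R : realType} {X Y : metricType R}.

Lemma coarse_inverse_sym (K L : R) (f : X -> Y) (g : Y -> X) :
  coarse_inverse K L f g -> coarse_inverse K L g f.
Proof. by case. Qed.

Lemma coarse_inverse_id : coarse_inverse (1 : R) 0 (@id X) id.
Proof. by split=> // *; rewrite ?mul1r ?addr0 ?mdistxx. Qed.

Lemma coarse_expand (K L : R) (f : X -> Y) (g : Y -> X) x x' :
  coarse_inverse K L f g -> mdist x x' <= K * mdist (f x) (f x') + 3 * L.
Proof.
case=> _ _ _ hg gf _.
have := metric_triangle x (g (f x)) x'.
have := metric_triangle (g (f x)) (g (f x')) x'.
have := hg (f x) (f x'); have := gf x; have := gf x'.
by rewrite (metric_sym x (g (f x))); lra.
Qed.

Lemma quasi_isometric_coarse_inverse : X -> quasi_isometric X Y ->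
  exists K L (f : X -> Y) (g : Y -> X), coarse_inverse K L f g.
Proof.
move=> x0 [K [L [f [K0 fKL /choice[g fg]]]]].
(* Coarse surjectivity is strict, so a single point forces [0 < L]. *)
have L0 : 0 < L by rewrite (le_lt_trans _ (fg (f x0)))// mdist_ge0.
have low x x' : mdist x x' <= K * (mdist (f x) (f x') + L).
  by rewrite -ler_pdivrMl// -lerBlDr; case: (fKL x x').
have up x x' := (fKL x x').2.
have KL0 : 0 <= K * L by rewrite mulr_ge0// ltW.
(* The second summand comes from d(g y, g y') <= K (d(f g y, f g y') + L) <= K (d(y, y') + 3 L). *)
exists K, (L + 3 * (K * L)), f, g; split.
- exact: ltW.
- by lra.
- by move=> x x'; rewrite (le_trans (up x x'))//; lra.
- move=> y y'; rewrite (le_trans (low _ _))//.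
  have : mdist (f (g y)) (f (g y')) + L <= mdist y y' + 3 * L.
    have := metric_triangle (f (g y)) y (f (g y')).
    have := metric_triangle y y' (f (g y')).
    by have := fg y; have := fg y'; rewrite (metric_sym y (f (g y))); lra.
  by move=> /(ler_wpM2l (ltW K0)); lra.
- move=> x; rewrite (le_trans (low _ _))//.
  have : mdist (f (g (f x))) (f x) + L <= 2 * L.
    by have := fg (f x); rewrite metric_sym; lra.
  by move=> /(ler_wpM2l (ltW K0)); lra.
- by move=> y; have := fg y; rewrite metric_sym; lra.
Qed.

End CoarseInverses.

(** * Images of contracting rays *)

Section Slim.
Context {R : realType} {Y : metricType R}.

Lemma segment_mdist (x y : Y) e s t : segment_map x y e ->
  0 <= s -> s <= t -> t <= mdist x y -> mdist (e s) (e t) = t - s.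
Proof.
move=> [_ _ h] s0 st tl; rewrite h ?in_itv/= ?s0 ?(le_trans s0 st)//.
  by rewrite distrC ger0_norm// subr_ge0.
exact: le_trans tl.
Qed.

Lemma segment_mdist_norm (x y : Y) e s t : segment_map x y e ->
  0 <= s <= mdist x y -> 0 <= t <= mdist x y -> mdist (e s) (e t) = `|s - t|.
Proof. by move=> [_ _ h] hs ht; rewrite h ?in_itv. Qed.

Lemma segment_mdist_start (x y : Y) e t : segment_map x y e ->
  0 <= t -> t <= mdist x y -> mdist x (e t) = t.
Proof.
move=> eseg t0 tl; have [e0 _ _] := eseg.
by rewrite -[X in mdist X _]e0 (segment_mdist eseg)// subr0.
Qed.

Lemma segment_mdist_end (x y : Y) e t : segment_map x y e ->
  0 <= t -> t <= mdist x y -> mdist (e t) y = mdist x y - t.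
Proof.
move=> eseg t0 tl; have [_ e1 _] := eseg.
by rewrite -[X in mdist (e t) X]e1 (segment_mdist eseg).
Qed.

Definition slim (delta : R) (c : ray Y) := forall y s (e : R -> Y), 0 <= s ->
  segment_map y (c s) e ->
  exists2 t, 0 <= t <= mdist y (c s) & mdist (e t) (proj c y) <= delta.

(** Let [c s] and [c t] be the projections of [x] and [y]. The segment [y, c s] lies in the ball
    around [x] through [c s] and passes near [c t], so [c t] is at most [delta] farther from [x]
    than [c s]. As [x, c t] passes within [delta] of [c s], at most [2 * delta] of it remains there.
    The added 1 makes the bound strict. *)
Lemma slim_contracting (delta : R) (c : ray Y) : CAT0 Y -> 0 <= delta ->
  slim delta c -> contracting_with (3 * delta + 1) c.
Proof.
move=> catY delta0 slim_c; split=> [|x y xy]; first by lra.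
have [s s0 px] := proj_ray c x; have [t t0 qy] := proj_ray c y.
have [e eseg] := segment_exists catY.1 y (c s).
have [e' e'seg] := segment_exists catY.1 x (c t).
have [u /andP[u0 ul] hu] := slim_c _ _ _ s0 eseg.
have [u' /andP[u'0 u'l] hu'] := slim_c _ _ _ t0 e'seg.
have : mdist x (e u) <= mdist x (c s).
  apply: (@cat0_ball_convex _ _ catY x y (c s)) => //.
    by rewrite (segment_mdist_start eseg)// (segment_mdist_end eseg)//; lra.
  by rewrite -px ltW.
have := segment_mdist_start e'seg u'0 u'l; have := segment_mdist_end e'seg u'0 u'l.
rewrite px qy in xy hu hu' *.
have := metric_triangle x (e u) (c t).
have := metric_triangle x (e' u') (c s).
have := metric_triangle (c s) (e' u') (c t).
by rewrite (metric_sym (c s) (e' u')); lra.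
Qed.

End Slim.

Section Shadows.
Context {R : realType} {X Y : metricType R}.

(** The image of [c'] under [g] is at finite Hausdorff distance from [c], with one constant for each
    direction. *)
Definition shadows (M1 M2 : R) (g : Y -> X) (c : ray X) (c' : ray Y) :=
  (forall u, 0 <= u -> mdist (g (c' u)) (proj c (g (c' u))) <= M1) /\
  (forall s, 0 <= s -> exists2 u, 0 <= u & mdist (g (c' u)) (c s) <= M2).

Lemma segment_coarse_lipschitz (K L : R) (g : Y -> X) (x y : Y) (e : R -> Y) :
  (forall y y', mdist (g y) (g y') <= K * mdist y y' + L) ->
  segment_map x y e -> coarse_lipschitz K L (mdist x y) (g \o e).
Proof.
move=> gKL eseg u v u_in v_in.
by rewrite (le_trans (gKL _ _))// (segment_mdist_norm eseg).
Qed.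

(** Serves in contrapositive form: [g] maps points far from [c'] far from [c]. *)
Lemma shadow_far (K L M1 M2 A : R) f g (c : ray X) (c' : ray Y) y :
  coarse_inverse K L f g -> shadows M1 M2 g c c' ->
  mdist (g y) (proj c (g y)) <= A ->
  exists2 u, 0 <= u & mdist y (c' u) <= K * (A + M2) + 3 * L.
Proof.
move=> cfg [_ C2] gyA; have [s s0 ps] := proj_ray c (g y).
have [u u0 hu] := C2 s s0; exists u => //.
rewrite (le_trans (coarse_expand _ _ (coarse_inverse_sym cfg)))// lerD2r.
rewrite ler_wpM2l ?(coarse_K cfg)//; rewrite ps in gyA.
rewrite (le_trans (metric_triangle _ (c s) _))// lerD//.
by rewrite metric_sym.
Qed.

(* Let q be the projection of y to c' and r = d(y, q).  Going from y along
   [y, c' s], let z be the first point after time r - T whose image under g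
   is A-close to c.  The two geodesics from the point at time r - T of [y, q]
   to the point at time r - T of [y, c' s] (which stays in a ball disjoint from
   the T-neighbourhood of c') and from there to z have total length at most
   3 d(q, z) + 3 T, while g maps them far away from c, so that their
   projections to c move by a small fraction of that length. *)
Lemma shadow_slim (K L D M1 M2 : R) (f : X -> Y) (g : Y -> X) :
  CAT0 Y -> coarse_inverse K L f g -> 0 < D -> 0 <= M1 -> 0 <= M2 ->
  exists2 delta, 0 <= delta & forall (c : ray X) (c' : ray Y),
    contracting_with D c -> shadows M1 M2 g c c' -> slim delta c'.
Proof.
move=> catY cfg D0 M10 M20.
have K0 := coarse_K cfg; have L0 := coarse_L cfg.
(* With [(k + k') * tau <= 3 * h + 3 * T + 2 * tau], the factor 6 makes the steps contribute at most
   [h / 2] plus a constant to the bound on [h]. [C0] collects the distances other than moves of the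
   projection, and [delta] results from solving for [h]. *)
pose tau := 6 * (K * D) + 1; pose A := K * tau + L + M1.
pose T := K * (A + M2) + 3 * L + 1.
pose C0 := 2 * (K * T + L) + M1 + A.
pose delta := T + tau + 2 * (K * C0) + 6 * L.
have tau0 : 0 < tau by rewrite ltr_wpDl// !mulr_ge0// ltW.
have A0 : 0 <= A by rewrite !addr_ge0// mulr_ge0// ltW.
have KA : K * tau + L <= A by rewrite /A; lra.
have T0 : 0 < T by rewrite ltr_wpDl// addr_ge0 ?mulr_ge0// addr_ge0.
have KT0 : 0 <= K * T by rewrite mulr_ge0// ltW.
have C00 : 0 <= C0 by rewrite /C0; lra.
have KC0 : 0 <= K * C0 by rewrite mulr_ge0.
have delta0 : 0 <= delta by rewrite /delta; lra.
exists delta => // c c' contr shad y s e s0 eseg.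
have [C1 C2] := shad.
have far y' : (forall u, 0 <= u -> T <= mdist y' (c' u)) ->
    A < mdist (g y') (proj c (g y')).
  move=> hy'; rewrite ltNge; apply/negP => /(shadow_far cfg shad)[v v0].
  by have := hy' v v0; rewrite /T; lra.
have [sq sq0 qE] := proj_ray c' y.
have qmin := proj_ray_min c' y; rewrite qE in qmin *.
set q := c' sq in qmin *; set r := mdist y q in qmin.
have [rT|Tr] := leP r T.
  exists 0; first by rewrite lexx mdist_ge0.
  have [-> _ _] := eseg; rewrite (le_trans rT)// /delta.
  by lra.
have ler := qmin s s0.
set l := mdist y (c' s) in ler *.
have lip := segment_coarse_lipschitz (coarse_g cfg) eseg.
have v_in : 0 <= r - T <= l by apply/andP; split; lra.
have [k [s1 [/andP[vs1 s1l] hs1 hk kt _]]] :=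
  projection_walk_forward contr lip K0 tau0 KA v_in.
rewrite /= in hs1 hk.
set v := e (r - T) in hk.
have gz : mdist (g (e s1)) (proj c (g (e s1))) <= A.
  case: hs1 => // ->; have [_ -> _] := eseg.
  rewrite (le_trans (C1 _ s0))// /A.
  by have := mulr_ge0 K0 (ltW tau0); lra.
set z := e s1 in hk gz.
have s10 : 0 <= s1 by lra.
have yz : mdist y z = s1 by rewrite (segment_mdist_start eseg).
have yv : mdist y v = r - T.
  by move/andP: v_in => [? ?]; rewrite (segment_mdist_start eseg).
have vz : mdist v z = s1 - (r - T).
  by move/andP: v_in => [? ?]; rewrite (segment_mdist eseg).
exists s1; first by rewrite s10.
rewrite -/z metric_sym; set h := mdist q z.
have s1h : s1 <= r + h by rewrite -yz /r /h; exact: metric_triangle.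
have [e2 e2seg] := segment_exists catY.1 y q.
have rT0 : 0 <= r - T by lra.
have rTr : r - T <= mdist y q by rewrite -/r; lra.
set w := e2 (r - T).
have yw : mdist y w = r - T by exact: (segment_mdist_start e2seg).
have wq : mdist w q = T by rewrite (segment_mdist_end e2seg)// -/r; ring.
have [e3 e3seg] := segment_exists catY.1 w v.
have lip3 := segment_coarse_lipschitz (coarse_g cfg) e3seg.
have wv_in : 0 <= mdist w v <= mdist w v by rewrite mdist_ge0 lexx.
have [k' [s2 [/andP[s20 s2l] hs2 hk' kt' _]]] :=
  projection_walk contr lip3 K0 tau0 KA wv_in.
(* The walk back from [v] gets all the way to [w]: by convexity [w, v] stays within [r - T] of [y],
   hence at least [T] away from [c']. *)
have s2E : s2 = 0.
  case: hs2 => // /= ge3; exfalso.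
  suff /far : forall u, 0 <= u -> T <= mdist (e3 s2) (c' u).
    by rewrite ltNge ge3.
  move=> u u0.
  have : mdist y (e3 s2) <= r - T.
    apply: (@cat0_ball_convex _ _ catY y w v); rewrite ?yw ?yv//.
    by rewrite (segment_mdist_start e3seg)// (segment_mdist_end e3seg)//; ring.
  by have := qmin u u0; have := metric_triangle y (e3 s2) (c' u); lra.
have [e30 e31 _] := e3seg.
rewrite /= s2E e30 e31 in hk'; rewrite s2E subr0 in kt'.
have wv : mdist w v <= T + h + (s1 - (r - T)).
  have := metric_triangle w q v; have := metric_triangle q z v.
  by rewrite (metric_sym z v) vz wq -/h; lra.
have gqw : mdist (g q) (g w) <= K * T + L.
  by rewrite (le_trans (coarse_g cfg _ _))// (metric_sym q w) wq.
have gw : mdist (g w) (proj c (g w)) <= K * T + L + M1.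
  have [p p0 pE] := proj_ray c (g q).
  rewrite (le_trans (proj_ray_min c (g w) p0))// -pE.
  rewrite (le_trans (metric_triangle _ (g q) _))// lerD ?C1//.
  by rewrite metric_sym.
have gqz : mdist (g q) (g z) <= (k%:R + k'%:R) * D + C0.
  have := metric_triangle (g q) (g w) (g z).
  have := metric_triangle (g w) (proj c (g w)) (g z).
  have := metric_triangle (proj c (g w)) (proj c (g v)) (g z).
  have := metric_triangle (proj c (g v)) (proj c (g z)) (g z).
  rewrite (metric_sym (proj c (g z)) (g z)).
  by rewrite (metric_sym (proj c (g v)) (proj c (g z))) /C0; lra.
have hgz : h <= K * ((k%:R + k'%:R) * D + C0) + 3 * L.
  rewrite (le_trans (coarse_expand _ _ (coarse_inverse_sym cfg)))// lerD2r.
  by rewrite ler_wpM2l.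
have kk : (k%:R + k'%:R) * tau <= 3 * h + 3 * T + 2 * tau by lra.
have k0 := ler0n R k; have k'0 := ler0n R k'.
have kk6 : 6 * (K * ((k%:R + k'%:R) * D)) <= (k%:R + k'%:R) * tau.
  by rewrite /tau; lra.
by rewrite /delta; lra.
Qed.

Lemma shadow_exists (K L D E : R) (f : X -> Y) (g : Y -> X) (y0 : Y) :
  proper_space Y -> geodesic_space Y -> coarse_inverse K L f g ->
  0 < D -> 0 <= E ->
  exists M1 M2, [/\ 0 <= M1, 0 <= M2 & forall c : ray X,
    contracting_with D c -> mdist (c 0) (g y0) <= E ->
    exists2 c' : ray Y, c' 0 = y0 & shadows M1 M2 g c c'].
Proof.
move=> properY gY cfg D0 E0.
have K0 := coarse_K cfg; have L0 := coarse_L cfg.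
(* The constant [3 * L] is that of [coarse_expand]; the ends [g y0] and [g (f (c n))] are within [E]
   and [L] of [c]. *)
have [M HM] := contracting_morse (X := X) (3 * L) D0 K0 L0 (addr_ge0 E0 L0).
have M_le := ler_norm M; have M_ge0 := normr_ge0 M.
(* [M1] is the Morse bound plus the displacement by [g] of points at distance 1; [M2] allows for a
   jump [2 * M1 + K + L] of [phi] below and for the offset [E] at the start. *)
pose M1 := `|M| + K + L; pose M2 := 3 * M1 + E + K + L.
have M10 : 0 <= M1 by rewrite /M1; lra.
exists M1, M2; split=> // [|c contr cE]; first by rewrite /M2; lra.
have /choice[e eseg] : forall n : nat, exists e, segment_map y0 (f (c n%:R)) e.
  by move=> n; exact: segment_exists.
pose l (n : nat) := mdist y0 (f (c n%:R)).
have [U [ultraU Uinf]] := nonprincipal_ultrafilter.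
have fU : ProperFilter U := ultra_proper.
have l_inf u : \forall n \near U, u <= l n.
  have [N hN] := natr_cofinal (K * u + E + 2 * L + 1).
  near=> n; rewrite leNgt; apply/negP => lu.
  have n0 := ler0n R n.
  have := hN n; have -> : (N <= n)%N by near: n.
  have := ler_wpM2l K0 (ltW lu); have := coarse_g cfg y0 (f (c n%:R)).
  have := metric_triangle (c 0) (g y0) (c n%:R).
  have := metric_triangle (g y0) (g (f (c n%:R))) (c n%:R).
  have := coarse_gf cfg (c n%:R).
  rewrite (ray_mdist0 c n0) -/(l n) => ? ? ? ? ? /(_ isT); lra.
have morse n u : 0 <= u <= l n ->
    mdist (g (e n u)) (proj c (g (e n u))) <= M.
  have [e0 e1 _] := eseg n.
  apply: (HM c (g \o e n)) => //=.
  - exact: segment_coarse_lipschitz (coarse_g cfg) (eseg n).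
  - move=> s t s_in t_in; rewrite -(segment_mdist_norm (eseg n))//.
    exact: coarse_expand (coarse_inverse_sym cfg).
  - rewrite e0 (le_trans (proj_ray_min c _ (lexx 0)))// metric_sym.
    by rewrite (le_trans cE)// lerDl.
  - rewrite e1 (le_trans (proj_ray_min c _ (ler0n _ n)))//.
    by rewrite (le_trans (coarse_gf cfg _))// lerDr.
have [||| c' hc'] := @ultralimit_geodesic R Y properY _ U ultraU `[0, +oo[ e y0 0 0.
- by rewrite in_itv/= lexx.
- move=> s t; rewrite !in_itv/= !andbT => s0 t0; near=> n.
  rewrite (segment_mdist_norm (eseg n))// ?s0 ?t0/=.
  + by near: n; exact: l_inf.
  + by near: n; exact: l_inf.
- by near=> n; have [-> _ _] := eseg n; rewrite mdistxx.
have {}hc' s : 0 <= s -> forall eps, 0 < eps ->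
    \forall n \near U, mdist (e n s) (c' s) < eps.
  by move=> s0; apply: hc'; rewrite in_itv/= s0.
have c'0 : c' 0 = y0.
  apply/mdist_positivity/eqP; rewrite eq_le mdist_ge0 andbT.
  apply/ler_addgt0Pl => eps eps0; rewrite addr0.
  near U => n; have [<- _ _] := eseg n.
  by rewrite metric_sym ltW//; near: n; exact: hc'.
have C1 u : 0 <= u -> mdist (g (c' u)) (proj c (g (c' u))) <= M1.
  move=> u0; near U => n.
  have ul : 0 <= u <= l n by rewrite u0/=; near: n; exact: l_inf.
  have ec' : mdist (e n u) (c' u) < 1 by near: n; exact: hc'.
  have [s s0 ps] := proj_ray c (g (e n u)).
  have := proj_ray_min c (g (c' u)) s0; rewrite -ps.
  have := morse n u ul.
  have := metric_triangle (g (c' u)) (g (e n u)) (proj c (g (e n u))).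
  have := coarse_g cfg (c' u) (e n u).
  have := ler_wpM2l K0 (ltW ec'); rewrite (metric_sym (c' u)) /M1.
  by lra.
exists c' => //; split=> // s s0.
(* The time [phi n] of a point of [c] near [g (c' n)] is unbounded with bounded jumps, so the first
   [n] with [s <= phi n] overshoots [s] by a bounded amount. For [n = 0] the bound is
   [phi 0 <= E + M1]. *)
have /choice[phi hphi] : forall n : nat, exists t,
    0 <= t /\ mdist (g (c' n%:R)) (c t) <= M1.
  move=> n; have [t t0 pt] := proj_ray c (g (c' n%:R)).
  by exists t; split=> //; rewrite -pt C1.
have phi_inf : exists n, s <= phi n.
  have [N hN] := natr_cofinal (K * (E + s + M1) + 3 * L + 1).
  exists N; rewrite leNgt; apply/negP => phis.
  have [p0 hp] := hphi N; have N0 := ler0n R N.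
  have := hN N (leqnn N).
  have := coarse_expand (c' 0) (c' N%:R) (coarse_inverse_sym cfg).
  rewrite (ray_mdist0 c' N0) c'0.
  have := metric_triangle (g y0) (c 0) (g (c' N%:R)).
  have := metric_triangle (c 0) (c (phi N)) (g (c' N%:R)).
  rewrite (ray_mdist0 c p0) (metric_sym (g y0) (c 0)) => h1 h2.
  have : mdist (g y0) (g (c' N%:R)) <= E + s + M1.
    by rewrite (metric_sym (c (phi N))) in h1; lra.
  by move=> /(ler_wpM2l K0); lra.
case: (ex_minnP phi_inf) => -[|n] sphi phi_min.
  have [p0 hp] := hphi 0%N.
  exists 0 => //; rewrite (le_trans (metric_triangle _ (c (phi 0%N)) _))//.
  have := metric_triangle (c 0) (g y0) (c (phi 0%N)).
  rewrite (ray_mdist0 c p0) metric_sym in hp *.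
  rewrite -c'0 in cE *; rewrite (metric_sym _ (c s)) ray_mdist_le// /M2.
  by rewrite (metric_sym (g _)) in hp *; lra.
have [p0 hp] := hphi n.+1; have [p0' hp'] := hphi n.
have phin : phi n < s.
  by rewrite ltNge; apply/negP => /phi_min; rewrite ltnn.
exists n.+1%:R => //; rewrite (le_trans (metric_triangle _ (c (phi n.+1)) _))//.
rewrite (metric_sym (c _) (c s)) ray_mdist_le//.
have : mdist (c (phi n)) (c (phi n.+1)) <= 2 * M1 + K + L.
  have := metric_triangle (c (phi n)) (g (c' n%:R)) (c (phi n.+1)).
  have := metric_triangle (g (c' n%:R)) (g (c' n.+1%:R)) (c (phi n.+1)).
  have := coarse_g cfg (c' n%:R) (c' n.+1%:R).
  have -> : mdist (c' n%:R) (c' n.+1%:R) = 1.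
    by rewrite ray_mdist_le ?ler_nat// -natr1 addrAC subrr add0r.
  by rewrite mulr1 (metric_sym (c _) (g _)); lra.
rewrite ray_mdist_le//; last by lra.
by rewrite /M2; lra.
Unshelve. all: by end_near. Qed.

(** One-sided and without matching times; for coarsely invertible [f] and fixed base points this
    determines the endpoint of [c'], see [boundary_rel_fun]. *)
Definition follows (M : R) (f : X -> Y) (c : ray X) (c' : ray Y) :=
  forall s, 0 <= s -> exists2 u, 0 <= u & mdist (f (c s)) (c' u) <= M.

Lemma shadows_follows (K L M1 M2 : R) f g (c : ray X) (c' : ray Y) :
  coarse_inverse K L f g -> shadows M1 M2 g c c' ->
  follows (K * M2 + 2 * L) f c c'.
Proof.
move=> cfg [_ C2] s s0; have [u u0 hu] := C2 s s0; exists u => //.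
have := metric_triangle (f (c s)) (f (g (c' u))) (c' u).
have := coarse_f cfg (c s) (g (c' u)); have := coarse_fg cfg (c' u).
have := ler_wpM2l (coarse_K cfg) hu; rewrite (metric_sym (g _)).
by lra.
Qed.

(** [m] and [M] are chosen before [c], so that a whole stage is sent into a single stage. *)
Theorem contracting_ray_image (K L D E : R) (f : X -> Y) (g : Y -> X) (y0 : Y) :
  proper_space Y -> CAT0 Y -> coarse_inverse K L f g -> 0 < D -> 0 <= E ->
  exists (m : nat) (M : R), forall c : ray X,
    contracting_with D c -> mdist (c 0) (g y0) <= E ->
    exists c' : ray Y, [/\ c' 0 = y0, contracting_with m%:R c' & follows M f c c'].
Proof.
move=> properY catY cfg D0 E0.
have [M1 [M2 [M10 M20 hM]]] := shadow_exists y0 properY catY.1 cfg D0 E0.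
have [delta delta0 hdelta] := shadow_slim catY cfg D0 M10 M20.
have [m hm] := natr_cofinal (3 * delta + 1).
exists m, (K * M2 + 2 * L) => c contr cE.
have [c' c'0 shad] := hM c contr cE.
exists c'; split=> //; last exact: shadows_follows cfg shad.
apply: contracting_with_le (hm m (leqnn m)) _.
by apply: slim_contracting => //; exact: hdelta contr shad.
Qed.

End Shadows.

(** * Visibility *)

Section Visibility.
Context {R : realType} {X : metricType R}.
Hypotheses (properX : proper_space X) (catX : CAT0 X).

(** Under the identity a ray shadows itself with both constants 0. *)
Lemma contracting_slim (D : R) (c : ray X) :
  contracting_with D c -> exists2 delta, 0 <= delta & slim delta c.
Proof.
move=> contr; have [D0 _] := contr.
have [delta delta0 h] :=
  shadow_slim catX coarse_inverse_id D0 (lexx 0) (lexx 0).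
exists delta => //; apply: h contr _; split=> [u u0|s s0].
  by rewrite proj_rayxx// mdistxx.
by exists s => //; rewrite mdistxx.
Qed.

Lemma follows_id_endpoint (M : R) (c c' : ray X) :
  follows M id c c' -> endpoint c = endpoint c'.
Proof.
move=> h; apply/endpoint_eqP; exists (mdist (c 0) (c' 0) + 2 * M) => t t0.
have [u u0 hu] := h t t0.
by have := close_ray_same_time c c' t0 u0; rewrite /= in hu; lra.
Qed.

(** The image of a contracting ray under the identity can be taken to start at [x0]. *)
Lemma contracting_boundary_stage (x0 : X) xi : contracting_boundary X xi ->
  exists n, contracting_stage x0 n xi.
Proof.
move=> [c [[D contr] <-]]; have [D0 _] := contr.
have [m [M h]] := contracting_ray_image x0 properX catX coarse_inverse_id D0
  (mdist_ge0 (c 0) x0).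
have [c' [c'0 c'm /follows_id_endpoint cc']] := h c contr (lexx _).
by exists m, c'; split.
Qed.

(** Thales with apex [c n] puts [z] near the point of [c] at the same ratio. The two lengths [n] and
    [b] differ by at most [B], so the time of that point differs from [t] by at most [B]. *)
Lemma cat0_segment_near_ray (c : ray X) (w z : X) (n t B : R) :
  0 <= t -> t <= n -> t <= mdist w (c n) -> mdist w z = t ->
  mdist z (c n) = mdist w (c n) - t -> mdist w (c 0) <= B ->
  mdist z (c t) <= 2 * B.
Proof.
move=> t0 tn tb wz zn wB.
have n0 := le_trans t0 tn.
have B0 : 0 <= B by rewrite (le_trans _ wB)// mdist_ge0.
set b := mdist w (c n) in tb zn.
have b0 : 0 <= b := mdist_ge0 _ _.
have [b_eq0|b_neq0] := eqVneq b 0.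
  have t_eq0 : t = 0 by lra.
  rewrite t_eq0 in wz *; rewrite -(mdist_positivity _ _ wz); lra.
have b_gt0 : 0 < b by rewrite lt_neqAle eq_sym b_neq0.
pose r := t / b.
have rb : r * b = t by rewrite /r divfK.
have r0 : 0 <= r by rewrite /r divr_ge0.
have r1 : r <= 1 by rewrite /r ler_pdivrMr// mul1r.
have rn0 : 0 <= r * n by rewrite mulr_ge0.
have rnn : r * n <= n by rewrite ler_piMl.
have q' : mdist (c n) (c (r * n)) = (1 - r) * mdist (c n) (c 0).
  by rewrite metric_sym (ray_mdist_le c rn0 rnn) metric_sym ray_mdist0//; ring.
have q'' : mdist (c (r * n)) (c 0) = (1 - (1 - r)) * mdist (c n) (c 0).
  rewrite metric_sym ray_mdist0// (metric_sym (c n)) ray_mdist0//; ring.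
have p' : mdist (c n) z = (1 - r) * mdist (c n) w.
  by rewrite metric_sym zn (metric_sym _ w) -/b mulrBl rb mul1r.
have p'' : mdist z w = (1 - (1 - r)) * mdist (c n) w.
  by rewrite (metric_sym _ w) wz (metric_sym _ w) -/b -rb; ring.
have r01 : 0 <= 1 - r <= 1 by apply/andP; split; lra.
have := cat0_thales catX r01 p' p'' q' q''.
have : (1 - r) * mdist w (c 0) <= B.
  have /andP[? ?] := r01.
  by rewrite (le_trans _ wB)// ler_piMl ?mdist_ge0.
have : mdist (c (r * n)) (c t) <= B.
  rewrite ray_mdist// -rb -mulrBr normrM (ger0_norm r0).
  have nb : `|n - b| <= B.
    have := metric_triangle (c 0) w (c n); have := metric_triangle w (c 0) (c n).
    rewrite ray_mdist0// (metric_sym (c 0) w) -/b ler_norml => ? ?.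
    by apply/andP; split; lra.
  by rewrite (le_trans _ nb)// ler_piMl.
by have := metric_triangle z (c (r * n)) (c t); lra.
Qed.

Lemma ray_rev_segment (b : ray X) (t : R) (x0 : X) : b 0 = x0 -> 0 <= t ->
  segment_map (b t) x0 (fun u => b (t - u)).
Proof.
move=> b0 t0; have bt : mdist (b t) x0 = t by rewrite metric_sym -b0 ray_mdist0.
split; rewrite ?subr0 ?bt ?subrr//.
move=> u v; rewrite !in_itv/= => /andP[_ ut] /andP[_ vt].
rewrite ray_mdist ?subr_ge0// (_ : t - u - (t - v) = v - u); last by ring.
exact: distrC.
Qed.

Lemma contracting_segments_near (D : R) (a b : ray X) :
  contracting_with D a -> a 0 = b 0 -> endpoint a <> endpoint b ->
  exists2 B, 0 <= B & forall (s t : R) e, 0 <= s -> 0 <= t ->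
    segment_map (b t) (a s) e ->
    exists2 u, 0 <= u <= mdist (b t) (a s) & mdist (a 0) (e u) <= B.
Proof.
move=> /contracting_slim[delta delta0 slim_a] ab nab.
have [S hS] : exists S, forall t s, 0 <= t -> 0 <= s ->
    proj a (b t) = a s -> s <= S.
  (* If the projections of [b] to [a] were unbounded, slimness for [b u, a 0], which runs along [b],
     would bring [b] within [delta] of arbitrarily late points of [a], and the rays would agree. *)
  apply: contrapT => nS; apply: nab; apply/endpoint_eqP; exists 0 => t t0.
  rewrite (cat0_rays_eq catX ab (C := delta)) ?mdistxx// => N.
  apply: contrapT => nN; apply: nS; exists N => u s u0 s0 ps.
  rewrite leNgt; apply/negP => Ns; apply: nN.
  have useg : segment_map (b u) (a 0) (fun v => b (u - v)).
    by apply: ray_rev_segment.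
  have [v /andP[v0 vu] hv] := slim_a _ _ _ (lexx 0) useg.
  exists s, (u - v); rewrite (ltW Ns) metric_sym -ps; split=> //.
  by rewrite subr_ge0 (le_trans vu)// ab metric_sym ray_mdist0.
exists (delta + Num.max 0 S) => [|s t e s0 t0 eseg].
  by rewrite addr_ge0// le_max lexx.
have [u u_in hu] := slim_a _ _ _ s0 eseg; exists u => //.
have [p p0 pE] := proj_ray a (b t); rewrite pE in hu.
have := metric_triangle (a 0) (a p) (e u).
rewrite ray_mdist0// (metric_sym (a p)).
have : p <= Num.max 0 S by rewrite le_max (hS t p)// orbT.
by lra.
Qed.

(** The segments [b n, a n] are parametrized from their point near the common origin, at time [r n].
    Both parts have length at least [n - B], so the ultralimit is a full line. *)
Theorem contracting_visibility (D : R) (a b : ray X) :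
  contracting_with D a -> a 0 = b 0 -> endpoint a <> endpoint b ->
  exists g : line X,
    endpoint (line_pos g) = endpoint a /\ endpoint (line_neg g) = endpoint b.
Proof.
move=> contr ab nab.
have [B B0 hB] := contracting_segments_near contr ab nab.
have /choice[e eseg] : forall n : nat, exists e,
    segment_map (b n%:R) (a n%:R) e.
  by move=> n; exact: segment_exists catX.1 _ _.
have /choice[r hr] : forall n : nat, exists u,
    0 <= u <= mdist (b n%:R) (a n%:R) /\ mdist (a 0) (e n u) <= B.
  by move=> n; have [u] := hB _ _ _ (ler0n R n) (ler0n R n) (eseg n); exists u.
pose l (n : nat) := mdist (b n%:R) (a n%:R).
have [U [ultraU Uinf]] := nonprincipal_ultrafilter.
have fU : ProperFilter U := ultra_proper.
have start n : mdist (b n%:R) (e n (r n)) = r n.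
  by have [/andP[? ?] _] := hr n; exact: (segment_mdist_start (eseg n)).
have stop n : mdist (e n (r n)) (a n%:R) = l n - r n.
  by have [/andP[? ?] _] := hr n; exact: (segment_mdist_end (eseg n)).
have r_ge n : n%:R - B <= r n.
  have := ray_mdist0 b (ler0n R n); have [_] := hr n; have := start n.
  have := metric_triangle (b 0) (e n (r n)) (b n%:R).
  by rewrite (metric_sym (b n%:R)) -ab; lra.
have lr_ge n : n%:R - B <= l n - r n.
  have := ray_mdist0 a (ler0n R n); have [_] := hr n; have := stop n.
  by have := metric_triangle (a 0) (e n (r n)) (a n%:R); lra.
have n_inf (t : R) : \forall n \near U, t <= n%:R.
  have [N hN] := natr_cofinal t.
  by near=> n; apply: hN; near: n.
have in_seg t n : `|t| + B <= n%:R -> 0 <= r n + t <= l n.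
  have := r_ge n; have := lr_ge n; have := ler_norm t; have := ler_norm (- t).
  by rewrite normrN => *; apply/andP; split; lra.
have [||| g hg] := @ultralimit_geodesic R X properX _ U ultraU
    `]-oo, +oo[ (fun n t => e n (r n + t)) (a 0) B 0.
- by rewrite in_itv.
- move=> s t _ _; near=> n.
  rewrite (segment_mdist_norm (eseg n)); last 2 first.
  + by apply: in_seg; near: n; exact: n_inf.
  + by apply: in_seg; near: n; exact: n_inf.
  by congr `| _ |; ring.
- by near=> n; rewrite addr0; case: (hr n).
(* After [r n] the segment leads from a point within [B] of [a 0] to [a n]; the 1 pays for the
   passage to the limit. *)
have near_a t : 0 <= t -> mdist (g t) (a t) <= 2 * B + 1.
  move=> t0; near U => n.
  have tn : `|t| + B <= n%:R by near: n; exact: n_inf.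
  rewrite (ger0_norm t0) in tn.
  have gt : mdist (e n (r n + t)) (g t) < 1 by near: n; exact: hg.
  have [/andP[r0 rl] wB] := hr n.
  have := lr_ge n; have := r_ge n => h1 h2.
  suff : mdist (e n (r n + t)) (a t) <= 2 * B.
    have := metric_triangle (g t) (e n (r n + t)) (a t).
    by rewrite (metric_sym (g t) (e n _)); lra.
  apply: (@cat0_segment_near_ray _ (e n (r n)) _ n%:R) => //.
  - by lra.
  - by rewrite stop; lra.
  - by rewrite (segment_mdist (eseg n))//; rewrite -/(l n); lra.
  - rewrite stop (segment_mdist_end (eseg n)) -/(l n); lra.
  - by rewrite metric_sym.
have near_b t : 0 <= t -> mdist (g (- t)) (b t) <= 2 * B + 1.
  move=> t0; near U => n.
  have tn : `|t| + B <= n%:R by near: n; exact: n_inf.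
  rewrite (ger0_norm t0) in tn.
  have gt : mdist (e n (r n - t)) (g (- t)) < 1 by near: n; exact: hg.
  have [/andP[r0 rl] wB] := hr n.
  have := lr_ge n; have := r_ge n => h1 h2.
  suff : mdist (e n (r n - t)) (b t) <= 2 * B.
    have := metric_triangle (g (- t)) (e n (r n - t)) (b t).
    by rewrite (metric_sym (g (- t)) (e n _)); lra.
  apply: (@cat0_segment_near_ray _ (e n (r n)) _ n%:R) => //.
  - by lra.
  - by rewrite metric_sym start; lra.
  - by rewrite metric_sym (segment_mdist (eseg n))//; rewrite -/(l n); lra.
  - rewrite (metric_sym _ (b _)) (segment_mdist_start (eseg n)); last 2 first.
    + lra.
    + rewrite -/(l n); lra.
    by rewrite (metric_sym _ (b _)) start.
  - by rewrite metric_sym -ab.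
exists g; split; apply/endpoint_eqP; exists (2 * B + 1) => t t0 /=.
  exact: near_a.
exact: near_b.
Unshelve. all: by end_near. Qed.

End Visibility.

(** * Sigma-compactness *)

Section Limits.
Context {R : realType} {X : metricType R}.
Hypotheses (properX : proper_space X) (catX : CAT0 X).
Context {T : Type} {U : set_system T}.
Hypothesis ultraU : UltraFilter U.

Let fU : ProperFilter U. Proof. exact: ultra_proper. Qed.

Definition ray_converges (c : T -> ray X) (c' : ray X) := forall t, 0 <= t ->
  forall e, 0 < e -> \forall i \near U, mdist (c i t) (c' t) < e.

Lemma ray_limit (c : T -> ray X) (x0 : X) :
  (\forall i \near U, c i 0 = x0) ->
  exists2 c' : ray X, c' 0 = x0 & ray_converges c c'.
Proof.
move=> cx0.
have [||| c' hc'] := @ultralimit_geodesic R X properX _ U ultraU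
    `[0, +oo[ (fun i => c i) x0 0 0.
- by rewrite in_itv/= lexx.
- move=> s t; rewrite !in_itv/= !andbT => s0 t0.
  by near=> i; exact: ray_mdist.
- near=> i; rewrite (_ : c i 0 = x0) ?mdistxx//.
  by near: i.
have {}hc' : ray_converges c c'.
  by move=> t t0; apply: hc'; rewrite in_itv/= t0.
exists c' => //; apply/mdist_positivity/eqP; rewrite eq_le mdist_ge0 andbT.
apply/ler_addgt0Pl => e e0; rewrite addr0; near U => i.
have <- : c i 0 = x0 by near: i.
by rewrite metric_sym ltW//; near: i; exact: hc'.
Unshelve. all: by end_near. Qed.

(** The projections of [x] are bounded and have an ultralimit [p]. It lies on [c'], at time
    [mdist x0 p], and is nearest to [x]; uniqueness concludes. *)
Lemma proj_limit (c : T -> ray X) (c' : ray X) (x0 : X) :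
  (\forall i \near U, c i 0 = x0) -> c' 0 = x0 -> ray_converges c c' ->
  forall x e, 0 < e ->
  \forall i \near U, mdist (proj (c i) x) (proj c' x) < e.
Proof.
move=> cx0 c'x0 cc' x.
have [|p hp] := @ultralimit_point R X properX _ U ultraU
  (fun i => proj (c i) x) x0 (2 * mdist x0 x).
  near=> i; have ci : c i 0 = x0 by near: i.
  have := proj_ray_min (c i) x (lexx 0); rewrite ci.
  have := metric_triangle x0 x (proj (c i) x).
  by rewrite (metric_sym x x0); lra.
suff -> : proj c' x = p by [].
pose s := mdist x0 p; have s0 : 0 <= s := mdist_ge0 _ _.
have ps : p = c' s.
  apply/mdist_positivity/eqP; rewrite eq_le mdist_ge0 andbT.
  apply/ler_addgt0Pl => e e0; rewrite addr0.
  have e30 : 0 < e / 3 by rewrite divr_gt0.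
  near U => i; have ci : c i 0 = x0 by near: i.
  have h1 : mdist (proj (c i) x) p < e / 3 by near: i; exact: hp.
  have h2 : mdist (c i s) (c' s) < e / 3 by near: i; exact: cc'.
  have [si si0 pE] := proj_ray (c i) x; rewrite pE in h1.
  have h3 : mdist (c i si) (c i s) <= e / 3.
    rewrite ray_mdist// ler_norml.
    have := metric_triangle (c i 0) p (c i si).
    have := metric_triangle (c i 0) (c i si) p.
    rewrite ray_mdist0// ci -/s (metric_sym p) => ? ?.
    by apply/andP; split; lra.
  have := metric_triangle p (c i si) (c' s).
  have := metric_triangle (c i si) (c i s) (c' s).
  by rewrite (metric_sym p (c i si)); lra.
have [t t0 tE] := proj_ray c' x.
rewrite tE ps; apply: (cat0_nearest_unique catX t0 s0).
  by move=> u u0; rewrite -tE; exact: proj_ray_min.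
move=> u u0; rewrite -ps; apply/ler_addgt0Pr => e e0.
have e20 : 0 < e / 2 by rewrite divr_gt0.
near U => i.
have h1 : mdist (proj (c i) x) p < e / 2 by near: i; exact: hp.
have h2 : mdist (c i u) (c' u) < e / 2 by near: i; exact: cc'.
have := proj_ray_min (c i) x u0.
have := metric_triangle x (proj (c i) x) p.
by have := metric_triangle x (c' u) (c i u); rewrite (metric_sym (c' u)); lra.
Unshelve. all: by end_near. Qed.

(** The non-strict inequality survives limits. *)
Definition weakly_contracting (D : R) (c : ray X) := forall x y,
  mdist x y < mdist x (proj c x) -> mdist (proj c x) (proj c y) <= D.

(** The premise is open, so it passes from [c'] to [c i] eventually; the conclusion is closed and
    passes back. *)
Lemma weakly_contracting_limit (D : R) (c : T -> ray X) (c' : ray X) (x0 : X) :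
  (\forall i \near U, c i 0 = x0) -> c' 0 = x0 -> ray_converges c c' ->
  (\forall i \near U, weakly_contracting D (c i)) -> weakly_contracting D c'.
Proof.
move=> cx0 c'x0 cc' cD x y xy.
have pl := proj_limit cx0 c'x0 cc'.
apply/ler_addgt0Pr => e e0.
have e20 : 0 < e / 2 by rewrite divr_gt0.
have d0 : 0 < mdist x (proj c' x) - mdist x y by rewrite subr_gt0.
near U => i.
have hD : weakly_contracting D (c i) by near: i.
have h1 : mdist (proj (c i) x) (proj c' x) < e / 2 by near: i; exact: pl.
have h2 : mdist (proj (c i) y) (proj c' y) < e / 2 by near: i; exact: pl.
have h3 : mdist (proj (c i) x) (proj c' x) < mdist x (proj c' x) - mdist x y.
  by near: i; exact: pl.
have : mdist (proj (c i) x) (proj (c i) y) <= D.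
  by apply: hD; have := metric_triangle x (proj (c i) x) (proj c' x); lra.
have := metric_triangle (proj c' x) (proj (c i) x) (proj c' y).
have := metric_triangle (proj (c i) x) (proj (c i) y) (proj c' y).
by rewrite (metric_sym (proj c' x) (proj (c i) x)); lra.
Unshelve. all: by end_near. Qed.

End Limits.

(** * The direct limit topology through cone neighbourhoods, and compact pieces *)

Section LimitTopology.
Context {R : realType} {X : metricType R}.
Hypotheses (properX : proper_space X) (catX : CAT0 X).
Variable x0 : X.

Definition stage_open (n : nat) (A : set (visual_boundary X)) :=
  forall c : ray X, c 0 = x0 -> contracting_stage x0 n (endpoint c) ->
  A (endpoint c) -> exists r e : R, [/\ 0 < r, 0 < e &
    cone_nbhs x0 c r e `&` contracting_stage x0 n `<=` A].

(** For [A] relatively open in a stage [S], this set is open in the whole boundary and has the same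
    trace on [S] as [A]. *)
Lemma cone_open_interior (S A : set (visual_boundary X)) :
  cone_open x0 [set xi | exists c : ray X, [/\ c 0 = x0, endpoint c = xi &
    exists r e : R, [/\ 0 < r, 0 < e & cone_nbhs x0 c r e `&` S `<=` A]]].
Proof.
move=> c cx0 [b [bx0 bc [r [e [r0 e0 sub]]]]].
exists r, (e / 2); split; rewrite ?divr_gt0// => _ [a [ax0 ac <-]].
exists a; split=> //; exists r, (e / 2); split; rewrite ?divr_gt0//.
move=> _ [[d [dx0 da <-]] Sd]; apply: sub; split=> //.
exists d; split=> // t t_in; have /andP[t0 _] := t_in.
have -> : b t = c t by apply: (cat0_endpoint_inj catX) => //; rewrite bx0.
have := da t t_in; have := ac t t_in.
by have := metric_triangle (d t) (a t) (c t); lra.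
Qed.

Lemma stage_openP n (A : set (visual_boundary X)) :
  open (A : set (stage_space x0 n)) <-> stage_open n A.
Proof.
rewrite /stage_space; split.
  move=> /open_subspaceP[V oV VA] c cx0 cn cA.
  have : (V `&` (contracting_stage x0 n)) (endpoint c) by rewrite VA.
  move=> [Vc _]; have [r [e [r0 e0 sub]]] : exists r e : R,
      [/\ 0 < r, 0 < e & cone_nbhs x0 c r e `<=` V] by exact: oV.
  exists r, e; split=> // xi [/sub Vxi Sxi].
  by have : (V `&` (contracting_stage x0 n)) xi by []; rewrite VA => -[].
move=> hA; apply/open_subspaceP.
exists [set xi | exists c : ray X, [/\ c 0 = x0, endpoint c = xi &
    exists r e : R, [/\ 0 < r, 0 < e &
      cone_nbhs x0 c r e `&` contracting_stage x0 n `<=` A]]].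
  exact: cone_open_interior.
apply/seteqP; split=> xi [h Sxi]; split=> //.
  move: h => [c [cx0 cxi [r [e [r0 e0 sub]]]]]; apply: sub; split=> //.
  by exists c; split=> // t _; rewrite mdistxx.
have [c [cx0 cn cxi]] := Sxi; exists c; split=> //.
by apply: hA => //; rewrite cxi.
Qed.

Lemma limit_openP (V : set (limit_boundary x0)) :
  open V <-> forall n, stage_open n (val @` V).
Proof.
have -> : open V = limit_open V by [].
split=> [oV n|h n].
  have /stage_openP hV := oV n.
  move=> c cx0 cn cV; have [|r [e [r0 e0 sub]]] := hV c cx0 cn; first by split.
  by exists r, e; split=> // xi /sub[].
apply/stage_openP => c cx0 cn [cV _].
have [r [e [r0 e0 sub]]] := h n c cx0 cn cV; exists r, e; split=> //.
by move=> xi [cxi Sxi]; split=> //; apply: sub.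
Qed.

Definition weak_stage (n : nat) : set (visual_boundary X) := [set xi |
  exists c : ray X, [/\ c 0 = x0, weakly_contracting n%:R c & endpoint c = xi]].

Lemma weak_stageS n : weak_stage n `<=` contracting_stage x0 n.+1.
Proof.
move=> xi [c [cx0 cn cxi]]; exists c; split=> //; split; first by rewrite ltr0n.
by move=> x y /cn /le_lt_trans; apply; rewrite ltr_nat.
Qed.

Lemma stage_weak_stage n : contracting_stage x0 n `<=` weak_stage n.
Proof.
by move=> xi [c [cx0 [_ cn] cxi]]; exists c; split=> // x y /cn /ltW.
Qed.

(** Representing rays converge along an ultrafilter to a weakly contracting ray. All points involved
    lie in stage [n.+1], so convergence in the direct limit is tested there. *)
Lemma weak_stage_compact n :
  compact ([set xi | weak_stage n (val xi)] : set (limit_boundary x0)).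
Proof.
rewrite compact_ultra => F ultraF FK.
have fF : ProperFilter F := ultra_proper.
have /choice[c hc] : forall xi : limit_boundary x0, exists c : ray X,
    weak_stage n (val xi) ->
    [/\ c 0 = x0, weakly_contracting n%:R c & endpoint c = val xi].
  move=> xi; have [c _] := set_valP xi.
  by have [[b hb]|nK] := pselect (weak_stage n (val xi)); [exists b|exists c].
have cx0 : \forall xi \near F, c xi 0 = x0.
  by apply: filterS FK => xi /hc[].
have cn : \forall xi \near F, weakly_contracting n%:R (c xi).
  by apply: filterS FK => xi /hc[].
have [c' c'x0 cc'] := ray_limit properX ultraF cx0.
have c'n := weakly_contracting_limit properX catX ultraF cx0 c'x0 cc' cn.
have c'K : weak_stage n (endpoint c') by exists c'.
have c'S := weak_stageS c'K.
have c'B := contracting_stage_sub c'S.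
pose xi' : limit_boundary x0 := SigSub (mem_set c'B).
exists xi'; split=> // V; rewrite nbhsE => -[W [oW Wxi'] WV].
apply: (filterS WV).
have /limit_openP/(_ n.+1 c' c'x0 c'S)[|r [e [r0 e0 sub]]] := oW.
  by exists xi'.
(* The single time [r] suffices: rays from [x0] are no farther apart at earlier times. *)
have close := cc' r (ltW r0) e e0.
near=> xi.
have xiK : weak_stage n (val xi) by near: xi.
have [cxi0 _ cxiE] := hc xi xiK.
have /sub[eta Weta /val_inj <-//] :
    (cone_nbhs x0 c' r e `&` contracting_stage x0 n.+1) (val xi).
split; last exact: weak_stageS.
exists (c xi); split=> // t /andP[t0 tr].
have re : mdist (c xi r) (c' r) < e by near: xi.
have cxic' : c xi 0 = c' 0 by rewrite c'x0.
have := cat0_rays_converge catX cxic' t0 (ltW tr).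
have : t * mdist (c xi r) (c' r) <= r * mdist (c xi r) (c' r).
  by rewrite ler_wpM2r ?mdist_ge0// ltW.
move=> h1 h2; have := le_trans h2 h1.
by rewrite mulrC ler_pM2l// => /le_lt_trans; apply.
Unshelve. all: by end_near. Qed.

Theorem limit_boundary_sigma_compact : sigma_compact (limit_boundary x0).
Proof.
exists (fun n => [set xi | weak_stage n (val xi)]); split.
  exact: weak_stage_compact.
apply/seteqP; split=> // xi _.
have [n hn] := contracting_boundary_stage properX catX x0 (set_valP xi).
by exists n => //=; exact: stage_weak_stage.
Qed.

End LimitTopology.

(** * Quasi-isometry invariance *)

Section BoundaryRelation.
Context {R : realType} {X Y : metricType R}.
Hypotheses (properX : proper_space X) (catX : CAT0 X).
Hypotheses (properY : proper_space Y) (catY : CAT0 Y).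
Variables (x0 : X) (y0 : Y) (K L : R) (f : X -> Y) (g : Y -> X).
Hypothesis cfg : coarse_inverse K L f g.

(** A relation, because image rays arise from choices; [boundary_rel_fun] shows that it is
    functional. *)
Definition boundary_rel (M : R) (xi : visual_boundary X)
    (eta : visual_boundary Y) :=
  exists (c : ray X) (c' : ray Y), [/\ c 0 = x0, c' 0 = y0, endpoint c = xi,
    endpoint c' = eta & follows M f c c'].

Lemma boundary_rel_stage n : exists m M, forall xi,
  contracting_stage x0 n xi ->
  exists2 eta, contracting_stage y0 m eta & boundary_rel M xi eta.
Proof.
(* The constant passed to [contracting_ray_image] must be positive, also for [n = 0]. *)
have n1 : 0 < n%:R + 1 :> R by rewrite ltr_wpDl.
have [m [M hM]] := contracting_ray_image y0 properY catY cfg n1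
  (mdist_ge0 x0 (g y0)).
exists m, M => xi [c [cx0 cn cxi]].
have [||c' [c'y0 c'm cc']] := hM c.
- by apply: contracting_with_le cn; rewrite lerDl.
- by rewrite cx0.
by exists (endpoint c'); [exists c'|exists c, c'].
Qed.

Lemma boundary_rel_ray M xi eta (c : ray X) (c' : ray Y) :
  boundary_rel M xi eta -> c 0 = x0 -> endpoint c = xi ->
  c' 0 = y0 -> endpoint c' = eta -> follows M f c c'.
Proof.
move=> [a [a' [ax0 a'y0 axi a'eta h]]] cx0 cxi c'y0 c'eta s s0.
have -> : c s = a s.
  by apply: (cat0_endpoint_inj catX); rewrite ?cx0 ?ax0 ?cxi ?axi.
have [u u0 hu] := h s s0; exists u => //.
have -> // : c' u = a' u.
by apply: (cat0_endpoint_inj catY); rewrite ?c'y0 ?a'y0 ?c'eta ?a'eta.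
Qed.

Lemma follows_time_ge M (c : ray X) (c' : ray Y) s u : c 0 = x0 -> c' 0 = y0 ->
  0 <= s -> 0 <= u -> mdist (f (c s)) (c' u) <= M ->
  s <= K * (mdist (f x0) y0 + u + M) + 3 * L.
Proof.
move=> cx0 c'y0 s0 u0 h.
have := coarse_expand (c 0) (c s) cfg; rewrite ray_mdist0// cx0.
have : mdist (f x0) (f (c s)) <= mdist (f x0) y0 + u + M.
  have := metric_triangle (f x0) y0 (f (c s)).
  have := metric_triangle y0 (c' u) (f (c s)).
  have := ray_mdist0 c' u0; rewrite c'y0 => ->.
  by rewrite (metric_sym (c' u) (f _)); lra.
move=> /(ler_wpM2l (coarse_K cfg)); lra.
Qed.

Lemma follows_time_unbounded M (c : ray X) (c' : ray Y) N :
  c 0 = x0 -> c' 0 = y0 -> follows M f c c' ->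
  exists s u, [/\ 0 <= s, N <= u, 0 <= u & mdist (f (c s)) (c' u) <= M].
Proof.
move=> cx0 c'y0 h.
pose b := K * (mdist (f x0) y0 + N + M) + 3 * L + 1.
have m0 : 0 <= Num.max 0 b by rewrite le_max lexx.
have [u u0 hu] := h _ m0; exists (Num.max 0 b), u; split=> //.
rewrite leNgt; apply/negP => uN.
have := follows_time_ge cx0 c'y0 m0 u0 hu.
have : b <= Num.max 0 b by rewrite le_max lexx orbT.
have := ler_wpM2l (coarse_K cfg) (ltW uN); rewrite /b; lra.
Qed.

(** Both image rays pass near the same points [f (a s)] at arbitrarily late times, so [cat0_rays_eq]
    applies. *)
Lemma boundary_rel_fun M M' xi eta eta' :
  boundary_rel M xi eta -> boundary_rel M' xi eta' -> eta = eta'.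
Proof.
move=> [a [a' [ax0 a'y0 axi a'eta ha]]] rel'.
have [_ [b' [_ b'y0 _ b'eta _]]] := rel'.
have hb := boundary_rel_ray rel' ax0 axi b'y0 b'eta.
rewrite -a'eta -b'eta; apply/endpoint_eqP; exists 0 => t t0.
rewrite (cat0_rays_eq catY (a := a') (b := b') (C := M + M')) ?mdistxx ?a'y0//.
move=> N; have [s [u [s0 Nu u0 hu]]] := follows_time_unbounded N ax0 a'y0 ha.
have [v v0 hv] := hb s s0; exists u, v; split=> //.
have := metric_triangle (a' u) (f (a s)) (b' v).
by rewrite (metric_sym (a' u) (f _)); lra.
Qed.

(** If [a s] is within 1 of [c s] at one late time [s], then [a'] comes within [C] of [c' u], and
    rays from [y0] that close at a late time are [e']-close before [r']. *)
Lemma follows_close M (c : ray X) (c' : ray Y) (r' e' : R) :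
  c 0 = x0 -> c' 0 = y0 -> follows M f c c' -> 0 < r' -> 0 < e' ->
  exists2 r, 0 < r & forall (a : ray X) (a' : ray Y), a' 0 = y0 ->
    follows M f a a' -> (forall t, 0 <= t < r -> mdist (a t) (c t) < 1) ->
    forall t, 0 <= t < r' -> mdist (a' t) (c' t) < e'.
Proof.
move=> cx0 c'y0 hc r'0 e'0.
(* [C] is two uses of [follows] plus the displacement by [f] at distance 1; [N <= u] gives [r' <= u]
   and [2 * C * r' / u < e']. *)
pose C := 2 * M + K + L; pose N := r' + 2 * C * r' / e'.
have [s [u [s0 Nu u0 hu]]] := follows_time_unbounded N cx0 c'y0 hc.
have M0 : 0 <= M by rewrite (le_trans _ hu)// mdist_ge0.
have K0 := coarse_K cfg; have L0 := coarse_L cfg.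
have C0 : 0 <= C by rewrite /C; lra.
exists (s + 1) => [|a a' a'y0 ha ac t /andP[t0 tr']]; first by lra.
have as1 : mdist (a s) (c s) < 1 by apply: ac; apply/andP; split; lra.
have [v v0 hv] := ha s s0.
have uv : mdist (c' u) (a' v) <= C.
  have := metric_triangle (c' u) (f (c s)) (a' v).
  have := metric_triangle (f (c s)) (f (a s)) (a' v).
  have := coarse_f cfg (c s) (a s); have := ler_wpM2l K0 (ltW as1).
  by rewrite (metric_sym (c' u) (f _)) (metric_sym (c s)) /C; lra.
have e'C : e' * (2 * C * r' / e') = 2 * C * r'.
  by rewrite mulrC divfK// gt_eqF.
have Cr0 : 0 <= 2 * C * r' / e' by rewrite divr_ge0 ?mulr_ge0// ltW.
have tu : t <= u by move: Nu; rewrite /N; lra.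
have c'a' : c' 0 = a' 0 by rewrite c'y0.
have close := cat0_rays_close catY c'a' t0 tu v0 uv.
have u_gt0 : 0 < u by move: Nu; rewrite /N; lra.
rewrite metric_sym -(ltr_pM2r u_gt0) (le_lt_trans close)//.
have : t * (2 * C) <= r' * (2 * C) by rewrite ler_wpM2r ?mulr_ge0// ltW.
have := ler_wpM2l (ltW e'0) Nu; have := mulr_gt0 e'0 r'0.
by rewrite /N mulrDr e'C; lra.
Qed.

(** Stage [n] goes into one stage [m] with one constant [M], so [follows_close] pulls cone
    neighbourhoods relative to stage [m] back to stage [n]. *)
Lemma boundary_map_continuous (h : limit_boundary x0 -> limit_boundary y0) :
  (forall xi, exists M, boundary_rel M (val xi) (val (h xi))) -> continuous h.
Proof.
move=> hrel; apply/continuousP => V /(limit_openP catY) oV.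
apply/(limit_openP catX) => n c cx0 cn [xi Vhxi xiE].
have [m [M hM]] := boundary_rel_stage n.
have stage_h (zeta : limit_boundary x0) : contracting_stage x0 n (val zeta) ->
    contracting_stage y0 m (val (h zeta)) /\
    boundary_rel M (val zeta) (val (h zeta)).
  (* The constant from [hrel] depends on the point; functionality replaces it by the uniform [M]. *)
  move=> /hM[eta etam rel]; have [M' rel'] := hrel zeta.
  by rewrite (boundary_rel_fun rel' rel).
have [] := stage_h xi; first by rewrite xiE.
move=> hxim rel; have [c' [c'y0 _ c'xi]] := hxim.
rewrite -c'xi in hxim.
have [|r' [e' [r'0 e'0 sub]]] := oV m c' c'y0 hxim.
  by exists (h xi) => //; rewrite c'xi.
have cxi : endpoint c = val xi by rewrite xiE.
have cc' := boundary_rel_ray rel cx0 cxi c'y0 c'xi.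
have [r r0 close] := follows_close cx0 c'y0 cc' r'0 e'0.
exists r, 1; split=> // eta [[a [ax0 ac aeta]] etan].
pose zeta : limit_boundary x0 := SigSub (mem_set (contracting_stage_sub etan)).
exists zeta => //; have [hzm relz] := stage_h zeta etan.
have [a' [a'y0 _ a'E]] := hzm.
have aa' := boundary_rel_ray relz ax0 aeta a'y0 a'E.
have /sub[zeta' Vz' /val_inj zE] :
    (cone_nbhs y0 c' r' e' `&` contracting_stage y0 m) (val (h zeta)).
  split=> //; exists a'; split=> //; exact: close a'y0 aa' ac.
by rewrite /= -zE.
Qed.

End BoundaryRelation.

(** * Mutually inverse boundary maps *)

Section BoundaryHomeomorphism.
Context {R : realType} {X Y : metricType R}.
Hypotheses (properX : proper_space X) (catX : CAT0 X).
Hypotheses (properY : proper_space Y) (catY : CAT0 Y).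
Variables (x0 : X) (y0 : Y).

Lemma boundary_map_exists (K L : R) (f : X -> Y) (g : Y -> X) :
  coarse_inverse K L f g ->
  exists h : limit_boundary x0 -> limit_boundary y0,
    forall xi, exists M, boundary_rel x0 y0 f M (val xi) (val (h xi)).
Proof.
move=> cfg.
suff /choice[h hrel] : forall xi : limit_boundary x0,
    exists eta : limit_boundary y0, exists M,
    boundary_rel x0 y0 f M (val xi) (val eta) by exists h.
move=> xi.
have [n hn] := contracting_boundary_stage properX catX x0 (set_valP xi).
have [m [M hM]] := boundary_rel_stage properY catY x0 y0 cfg n.
have [eta etam rel] := hM _ hn.
by exists (SigSub (mem_set (contracting_stage_sub etam))), M.
Qed.

(** Since [g (f (a s))] is near [a s], applying [f] and then [g] leads to a ray that [a] follows
    under the identity. *)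
Lemma boundary_rel_inverse (K L : R) (f : X -> Y) (g : Y -> X) M M' xi xi' eta :
  coarse_inverse K L f g -> boundary_rel x0 y0 f M xi eta ->
  boundary_rel y0 x0 g M' eta xi' -> xi' = xi.
Proof.
move=> cfg [a [a' [_ a'y0 <- a'eta ha]]] rel.
have [_ [b [_ bx0 _ bxi' _]]] := rel.
have hb := boundary_rel_ray catY catX rel a'y0 a'eta bx0 bxi'.
rewrite -bxi'; apply/esym.
apply: (@follows_id_endpoint _ _ (L + (K * M + L) + M')) => s s0.
have [u u0 hu] := ha s s0; have [v v0 hv] := hb u u0; exists v => //.
have := metric_triangle (a s) (g (f (a s))) (b v).
have := metric_triangle (g (f (a s))) (g (a' u)) (b v).
have := coarse_g cfg (f (a s)) (a' u); have := coarse_gf cfg (a s).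
have := ler_wpM2l (coarse_K cfg) hu.
by rewrite (metric_sym (a s) (g _)) /=; lra.
Qed.

End BoundaryHomeomorphism.

Theorem limit_boundary_homeomorphic (R : realType) (X Y : metricType R)
    (x0 : X) (y0 : Y) (K L : R) (f : X -> Y) (g : Y -> X) :
  proper_space X -> CAT0 X -> proper_space Y -> CAT0 Y ->
  coarse_inverse K L f g ->
  homeomorphic (limit_boundary x0) (limit_boundary y0).
Proof.
move=> properX catX properY catY cfg.
have cgf := coarse_inverse_sym cfg.
have [h hrel] := boundary_map_exists properX catX properY catY x0 y0 cfg.
have [k krel] := boundary_map_exists properY catY properX catX y0 x0 cgf.
exists h, k; split.
- move=> xi; apply: val_inj.
  have [M hM] := hrel xi; have [M' kM'] := krel (h xi).
  exact: (boundary_rel_inverse catX catY cfg hM kM').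
- move=> eta; apply: val_inj.
  have [M kM] := krel eta; have [M' hM'] := hrel (k eta).
  exact: (boundary_rel_inverse catY catX cgf kM hM').
- exact: (boundary_map_continuous catX properY catY cfg).
- exact: (boundary_map_continuous catY properX catX cgf).
Qed.

Theorem mainTheorem1 (R : realType) (X : metricType R)
    (properX : proper_space X) (cat0X : CAT0 X) (x0 : X) :
  [/\ sigma_compact (limit_boundary x0),
      visibility (contracting_boundary X)
    & forall (Y : metricType R) (properY : proper_space Y) (cat0Y : CAT0 Y)
             (y0 : Y),
        quasi_isometric X Y ->
        homeomorphic (limit_boundary x0) (limit_boundary y0)].
Proof.
split; first exact: limit_boundary_sigma_compact.
- move=> xi eta.
  (* Both points are represented by rays from [x0], which provides the common origin. *)
  move=> /(contracting_boundary_stage properX cat0X x0)[n [a [ax0 an axi]]].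
  move=> /(contracting_boundary_stage properX cat0X x0)[m [b [bx0 bm beta]]].
  rewrite -axi -beta => ab.
  by apply: (contracting_visibility properX cat0X an) => //; rewrite ax0.
- move=> Y properY cat0Y y0 /(quasi_isometric_coarse_inverse x0).
  by move=> [K [L [f [g cfg]]]]; exact: limit_boundary_homeomorphic cfg.
Qed.
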